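(* For every $n\ge 1$ and $k\ge 1$, the number of rushed Dyck paths of semilength $n+1$ and height $k+1$ equals the number of strong rectangulations of size $n$ in which every horizontal segment extends from the left side to the right side of the bounding rectangle, and which have exactly $k-1$ horizontal segments. In particular, the number of such strong rectangulations of size $n$ equals the number of rushed Dyck paths of semilength $n+1$ (sequence A287709 of the OEIS).
   Context: A rectangulation of an axis-aligned rectangle $R$ is a decomposition of $R$ into finitely many interior-disjoint axis-aligned rectangles; its size is the number of rectangles. A segment is a maximal straight line segment which is a union of sides of rectangles and is not contained in the boundary of $R$; rectangulations are generic (no two segments cross). For rectangles $X,Y$: $Y$ is right of $X$ if there is a sequence $X=X_1,\dots,X_k=Y$ such that for every $i$ there is a vertical segment containing the right side of $X_i$ and the left side of $X_{i+1}$; $Y$ is above $X$ analogously with horizontal segments. Two rectangulations are strongly equivalent if there is a bijection between their rectangles preserving the left–right and above–below relations and also preserving contacts (which pairs of rectangles have boundaries sharing a segment of positive length); a strong rectangulation is a strong equivalence class. A Dyck path of semilength $m$ is a lattice path from $(0,0)$ to $(2m,0)$ with steps $(1,1)$ and $(1,-1)$ never going below the $x$-axis; its height is the maximal altitude reached. A Dyck path is rushed if it starts with $h\ge 1$ up-steps and afterwards never visits altitude $h$ again. *)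

(* Defs.v *)
From mathcomp Require Import all_boot all_order all_algebra.
From mathcomp Require Import boolp classical_sets cardinality set_interval reals.

Set Implicit Arguments.
Unset Strict Implicit.
Unset Printing Implicit Defensive.

Import Order.TTheory GRing.Theory Num.Theory.

Local Open Scope classical_set_scope.
Local Open Scope ring_scope.

Record rect (R : realType) := Rect {
  xl : R; xr : R; yl : R; yr : R;
  xl_lt_xr : xl < xr;
  yl_lt_yr : yl < yr }.

Definition rect_set (R : realType) (r : rect R) : set (R * R) :=
  `[xl r, xr r] `*` `[yl r, yr r].

Definition rect_interior (R : realType) (r : rect R) : set (R * R) :=
  `]xl r, xr r[ `*` `]yl r, yr r[.

Definition rect_boundary (R : realType) (r : rect R) : set (R * R) :=
  rect_set r `\` rect_interior r.

Definition vert_line (R : realType) (x y1 y2 : R) : set (R * R) :=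
  [set x] `*` `[y1, y2].

Definition horiz_line (R : realType) (y x1 x2 : R) : set (R * R) :=
  `[x1, x2] `*` [set y].

Definition left_side (R : realType) (r : rect R) := vert_line (xl r) (yl r) (yr r).
Definition right_side (R : realType) (r : rect R) := vert_line (xr r) (yl r) (yr r).
Definition bottom_side (R : realType) (r : rect R) := horiz_line (yl r) (xl r) (xr r).
Definition top_side (R : realType) (r : rect R) := horiz_line (yr r) (xl r) (xr r).

Definition is_side (R : realType) (r : rect R) (s : set (R * R)) : Prop :=
  [\/ s = left_side r, s = right_side r, s = bottom_side r | s = top_side r].

Definition vertical (R : realType) (S : set (R * R)) : Prop :=
  exists x y1 y2, y1 < y2 /\ S = vert_line x y1 y2.

Definition horizontal (R : realType) (S : set (R * R)) : Prop :=
  exists y x1 x2, x1 < x2 /\ S = horiz_line y x1 x2.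

(* Only axis-parallel line segments are considered: a line segment that is a
   union of sides of axis-aligned rectangles, or that is contained in the
   boundary of one, is axis-parallel. *)
Definition straight (R : realType) (S : set (R * R)) : Prop :=
  vertical S \/ horizontal S.

Definition union_of_sides (R : realType) (n : nat) (T : 'I_n -> rect R)
    (S : set (R * R)) : Prop :=
  exists F : set (set (R * R)),
    (forall s, F s -> exists i, is_side (T i) s) /\ S = \bigcup_(s in F) s.

(* A line segment containing one that is not contained in the boundary of B is
   itself not contained in it, so that condition need not be repeated on S'. *)
Definition segment (R : realType) (B : rect R) (n : nat) (T : 'I_n -> rect R)
    (S : set (R * R)) : Prop :=
  [/\ straight S, union_of_sides T S, ~ S `<=` rect_boundary B &
      forall S', straight S' -> union_of_sides T S' -> S `<=` S' -> S' = S].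

Definition vsegment (R : realType) (B : rect R) (n : nat) (T : 'I_n -> rect R)
    (S : set (R * R)) : Prop := segment B T S /\ vertical S.

Definition hsegment (R : realType) (B : rect R) (n : nat) (T : 'I_n -> rect R)
    (S : set (R * R)) : Prop := segment B T S /\ horizontal S.

(* Two segments cross when they share a point interior to both. *)
Definition generic (R : realType) (B : rect R) (n : nat) (T : 'I_n -> rect R)
    : Prop :=
  forall x y1 y2 y x1 x2 : R,
    segment B T (vert_line x y1 y2) -> segment B T (horiz_line y x1 x2) ->
    ~ (x1 < x < x2 /\ y1 < y < y2).

(* The n rectangles carry labels in 'I_n, but strong equivalence ranges over
   all bijections of the labels, so the labelling does not affect classes. *)
Record rectangulation (R : realType) (B : rect R) (n : nat) := Rectangulation {
  tile :> 'I_n -> rect R;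
  tile_cover : \bigcup_i rect_set (tile i) = rect_set B;
  tile_disjoint : forall i j, i != j ->
    rect_interior (tile i) `&` rect_interior (tile j) = set0;
  tile_generic : generic B tile }.

Definition right_step (R : realType) (B : rect R) (n : nat)
    (T : rectangulation B n) (i j : 'I_n) : Prop :=
  exists S, [/\ vsegment B T S, right_side (T i) `<=` S & left_side (T j) `<=` S].

Definition above_step (R : realType) (B : rect R) (n : nat)
    (T : rectangulation B n) (i j : 'I_n) : Prop :=
  exists S, [/\ hsegment B T S, top_side (T i) `<=` S & bottom_side (T j) `<=` S].

(* [right_of T i j]: tile j is right of tile i.  Chains of length one are
   allowed, so these relations are reflexive; for the preservation of the
   relations by bijections this makes no difference, since no tile is strictly
   right of, or strictly above, itself. *)
Definition right_of (R : realType) (B : rect R) (n : nat)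
    (T : rectangulation B n) : rel 'I_n :=
  connect (fun i j => `[< right_step T i j >]).

Definition above (R : realType) (B : rect R) (n : nat)
    (T : rectangulation B n) : rel 'I_n :=
  connect (fun i j => `[< above_step T i j >]).

Definition contact (R : realType) (B : rect R) (n : nat)
    (T : rectangulation B n) (i j : 'I_n) : Prop :=
  exists S, [/\ straight S, S `<=` rect_boundary (T i) & S `<=` rect_boundary (T j)].

Definition strong_equiv (R : realType) (B : rect R) (n : nat)
    (T T' : rectangulation B n) : Prop :=
  exists f : 'I_n -> 'I_n,
    [/\ bijective f,
        forall i j, right_of T' (f i) (f j) = right_of T i j,
        forall i j, above T' (f i) (f j) = above T i j &
        forall i j, contact T' (f i) (f j) <-> contact T i j].

Definition strong_class (R : realType) (B : rect R) (n : nat)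
    (T : rectangulation B n) : set (rectangulation B n) :=
  [set T' | strong_equiv T T'].

Definition full_horizontals (R : realType) (B : rect R) (n : nat)
    (T : rectangulation B n) : Prop :=
  forall S, hsegment B T S -> exists y, S = horiz_line y (xl B) (xr B).

Definition strong_full (R : realType) (B : rect R) (n : nat)
    : set (set (rectangulation B n)) :=
  @strong_class R B n @` [set T | full_horizontals T].
Arguments strong_full {R} B n.

Definition strong_full_with (R : realType) (B : rect R) (n h : nat)
    : set (set (rectangulation B n)) :=
  @strong_class R B n @`
    [set T | full_horizontals T /\ ([set S | hsegment B T S] #= `I_h)%card].
Arguments strong_full_with {R} B n h.

(* Lattice paths are words of steps, [true] for (1,1) and [false] for (1,-1);
   [altitude p i] is the ordinate after i steps. *)
Definition altitude (p : seq bool) (i : nat) : int :=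
  (count_mem true (take i p))%:Z - (count_mem false (take i p))%:Z.

Definition dyck (m : nat) (p : (2 * m).-tuple bool) : bool :=
  [forall i : 'I_(2 * m).+1, 0 <= altitude p i] && (altitude p (2 * m) == 0).

(* On Dyck paths, altitudes are nonnegative and `|_| only casts them to nat. *)
Definition height (m : nat) (p : (2 * m).-tuple bool) : nat :=
  \max_(i < (2 * m).+1) `|altitude p i|%N.

Definition rushed (m : nat) (p : (2 * m).-tuple bool) : bool :=
  [exists h : 'I_(2 * m).+1,
    [&& (0 < h)%N, take h p == nseq h true &
        [forall i : 'I_(2 * m).+1, (h < i)%N ==> (altitude p i != h%:Z)]]].

Definition nb_rushed (m : nat) : nat :=
  #|[pred p : (2 * m).-tuple bool | dyck p && rushed p]|.

Definition nb_rushed_height (m h : nat) : nat :=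
  #|[pred p : (2 * m).-tuple bool | [&& dyck p, rushed p & height p == h]]|.

(* Main.v *)
(* The horizontal segments cut the rectangle into k rows.  A vertical segment
   lives in one row, adjacent rows are cut at different abscissas, and the strong
   class only records k and, for rows that are equal or adjacent, the order of
   their cuts.  Reading the rows of the cuts from left to right thus gives a word
   in 0, ..., k-1 of length n-k, defined up to commutation of letters differing by
   at least 2.  Each commutation class has a unique word without an ascent of 2 or
   more, and this normal word is the sequence of altitudes at which the up-steps
   of a path start, once the initial run of k+1 up-steps and the down-step that
   follows it are removed from a rushed Dyck path of height k+1. *)

Require Import Defs.
From mathcomp Require Import all_boot all_order all_algebra.
From mathcomp Require Import boolp classical_sets cardinality set_interval reals.
From mathcomp Require Import functions lra zify.

Set Implicit Arguments.
Unset Strict Implicit.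
Unset Printing Implicit Defensive.

Import Order.TTheory GRing.Theory Num.Theory.

Local Open Scope classical_set_scope.

(** * Normal words *)

(** Both sides are counted by the pairs of a number [k] of rows and a normal word. For
    rectangulations, the point is that a strong class carries neither less nor more than the order
    of the cuts in equal or adjacent rows. Not less: in adjacent rows, a tile starts left of another
    exactly when some tile weakly right of the first touches a tile strictly left of the second, so
    contacts reveal the order of left ends. Not more: a tile ends where the next tile of its row
    starts, so contacts can be rewritten with left ends alone.

    A normal word is unique because the projections of a word onto the pairs of letters j, j + 1 do
    not change under commutation, and they fix the first letter of a normal word. It exists by an
    insertion that only swaps commuting letters. For paths, normality reflects that only down-steps
    separate two consecutive up-steps; letters stay below [k] because a path that has left its
    initial altitude k + 1 downwards cannot pass it again. *)

Definition normal (v : seq nat) := sorted (fun a b => b <= a.+1) v.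

Definition near (a b : nat) := (a <= b.+1) && (b <= a.+1).

(* Steps go up by at most one, so [b.-1] is met before the first [b]. *)
Lemma normal_head (a b : nat) (s : seq nat) :
  normal (a :: s) -> a < b -> b \in s ->
  head 0 (filter (mem [:: b.-1; b]) (a :: s)) = b.-1.
Proof.
elim: s a => [//|c s IH] a; rewrite /normal /= => /andP[ca sn] ab.
rewrite !inE; case: (eqVneq a b.-1) => [-> //|ab1] /=.
have [e|_] /= := eqVneq a b; first by rewrite e ltnn in ab.
case: (eqVneq b c) => [bc|bc] /=; first by lia.
by move=> bs; have := IH c sn; rewrite /= !inE [c == b]eq_sym (negPf bc); apply=> //; lia.
Qed.

(** If [a < b], the projections onto [b.-1] and [b] start with [b.-1] on the left, by [normal_head],
    but with [b] on the right. *)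
Lemma normal_cons_le (a b : nat) (s t : seq nat) :
  normal (a :: s) ->
  (forall j, filter (mem [:: j; j.+1]) (a :: s) =
             filter (mem [:: j; j.+1]) (b :: t)) -> b <= a.
Proof.
move=> sn E; rewrite leqNgt; apply/negP => ab.
have bs : b \in s.
  have : b \in filter (mem [:: b; b.+1]) (a :: s) by rewrite E mem_filter !inE eqxx.
  by rewrite mem_filter !inE eqxx /= => /orP[/eqP e|//]; rewrite e ltnn in ab.
have := normal_head sn ab bs; have := E b.-1; rewrite prednK; last by lia.
by move=> ->; rewrite /= !inE eqxx orbT /=; lia.
Qed.

(** The first letters agree by antisymmetry and can then be cancelled from every projection. *)
Lemma normal_unique (v w : seq nat) :
  normal v -> normal w ->
  (forall j, filter (mem [:: j; j.+1]) v = filter (mem [:: j; j.+1]) w) -> v = w.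
Proof.
elim: v w => [|a s IH] [|b t] //.
- by move=> _ _ /(_ b); rewrite /= !inE eqxx.
- by move=> _ _ /(_ a); rewrite /= !inE eqxx.
move=> sn tn E; have ab : a = b.
  apply/eqP; rewrite eqn_leq (normal_cons_le sn E) andbT.
  exact: normal_cons_le tn (fun j => esym (E j)).
rewrite -{}ab in tn E *; congr (_ :: _); apply: IH.
- exact: path_sorted sn.
- exact: path_sorted tn.
- by move=> j; have := E j; rewrite /=; case: ifP => // _ [].
Qed.

(** * Existence of normal rearrangements *)

Section Insertion.
Variables (X : eqType) (r : X -> nat) (e : rel X).
Let lin : rel X := fun i j => near (r i) (r j) ==> e i j.
Let nrm : rel X := fun i j => r j <= (r i).+1.

(** Insertion with the non-transitive test [nrm]: [a] moves behind [b] only when [r b] exceeds [r a]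
    by at least 2, and then [lin] puts no constraint on the two. *)
Fixpoint commute_in (a : X) (s : seq X) : seq X :=
  if s is b :: s' then
    if nrm a b then a :: s else b :: commute_in a s'
  else [:: a].

Lemma perm_commute_in a s : perm_eq (commute_in a s) (a :: s).
Proof.
elim: s => [//|b s IH] /=; case: ifP => // _.
by rewrite -[a :: b :: s]/([:: a] ++ b :: s) perm_sym perm_catC /= perm_cons 
  perm_sym cats1 (perm_trans IH) // perm_sym perm_rcons.
Qed.

Lemma pairwise_commute_in a s :
  pairwise lin (a :: s) -> pairwise lin (commute_in a s).
Proof.
elim: s => [//|b s IH] /=; case: ifP => // nab /andP[/andP[_ la] /andP[lb ps]].
rewrite /= IH /= ?la ?ps // andbT (perm_all _ (perm_commute_in a s)) /= lb andbT.
by rewrite /lin; case nba : near => //; move: nba nab; rewrite /near /nrm; lia.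
Qed.

Lemma sorted_commute_in a s : sorted nrm s -> sorted nrm (commute_in a s).
Proof.
elim: s => [//|b s IH] /= pbs; case: ifP => [/= -> //|nab].
have := IH (path_sorted pbs); case: s pbs {IH} => [|c s] /= => [_ _|/andP[bc _]].
  by rewrite andbT; move: nab; rewrite /nrm; lia.
case: ifP => _ /= -> ; rewrite ?bc ?andbT //.
by move: nab; rewrite /nrm; lia.
Qed.

Lemma normal_rearrangement s : pairwise lin s ->
  exists2 t, perm_eq t s & pairwise lin t /\ sorted nrm t.
Proof.
elim: s => [_|a s IH]; first by exists [::].
move=> /= /andP[la /IH[t ts [pt st]]]; exists (commute_in a t).
  by rewrite (perm_trans (perm_commute_in a t)) // perm_cons.
split; last exact: sorted_commute_in.
by apply: pairwise_commute_in; rewrite /= pt (perm_all _ ts) la.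
Qed.
End Insertion.

(** * Rushed Dyck paths *)

(* The path from altitude [h] to 0 whose up-steps start at the altitudes [v];
   it is only meaningful when [h - u] never truncates. *)
Fixpoint path_of (h : nat) (v : seq nat) : seq bool :=
  if v is u :: v' then nseq (h - u) false ++ true :: path_of u.+1 v'
  else nseq h false.

Fixpoint up_altitudes (h : nat) (p : seq bool) : seq nat :=
  if p is b :: p' then
    if b then h :: up_altitudes h.+1 p' else up_altitudes h.-1 p'
  else [::].

Fixpoint strip_path (m h : nat) (p : seq bool) : bool :=
  if p is b :: p' then
    if b then (h < m) && strip_path m h.+1 p' else (0 < h) && strip_path m h.-1 p'
  else h == 0.

Lemma up_altitudes_nseq h d p :
  up_altitudes h (nseq d false ++ p) = up_altitudes (h - d) p.
Proof. by elim: d h => [|d IH] h /=; rewrite ?subn0 // IH; congr up_altitudes; lia. Qed.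

Lemma strip_path_nseq m h d p : d <= h ->
  strip_path m h (nseq d false ++ p) = strip_path m (h - d) p.
Proof.
elim: d h => [|d IH] h /=; rewrite ?subn0 // => dh.
by rewrite IH; [have -> : h.-1 - d = h - d.+1 by lia|]; lia.
Qed.

(** With [0 < h], the letter [h.-1] in front says that the first up-step starts at altitude at most
    [h]. This form survives the induction, since after an up-step from [u] the altitude is
    [u.+1]. *)
Lemma path_ofK h v : normal (h.-1 :: v) -> 0 < h -> up_altitudes h (path_of h v) = v.
Proof.
elim: v h => [|u v IH] h.
  by move=> _ _; rewrite -[path_of _ _]cats0 up_altitudes_nseq.
rewrite /normal /= => /andP[uh pv] h0.
rewrite up_altitudes_nseq /= subKn ?IH //; lia.
Qed.

Lemma strip_path_of m h v : normal (h.-1 :: v) -> 0 < h -> all (gtn m) v ->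
  strip_path m h (path_of h v).
Proof.
elim: v h => [|u v IH] h.
  by move=> _ _ _; rewrite -[path_of _ _]cats0 strip_path_nseq ?subnn.
rewrite /normal /= => /andP[uh pv] h0 /andP[um vm].
by rewrite strip_path_nseq ?subKn /= ?um ?IH //; lia.
Qed.

(** Between consecutive up-steps the path only descends, so the second starts at most one above the
    start of the first. The bound on the first letter carries this through the induction. *)
Lemma up_altitudes_strip m h p : strip_path m h p ->
  all (gtn m) (up_altitudes h p) /\ path_of h (up_altitudes h p) = p /\
   (if up_altitudes h p is u :: _ then u <= h else true) /\ 
   normal (up_altitudes h p).
Proof.
elim: p h => [|[] p IH] h /=.
- by move/eqP=> ->.
- move=> /andP[hm /IH[am [e [hd nm]]]]; rewrite hm am e subnn; split=> //.
  by do 2 split => //; rewrite /normal /=; move: hd nm; case: up_altitudes => //= u s -> ->.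
- move=> /andP[h0 /IH[am [e [hd nm]]]]; rewrite am; split=> //; split; last first.
    by split => //; move: hd; case: up_altitudes => //= u s; lia.
  move: e hd; case: up_altitudes => [|u s] /=.
    by move=> <-; case: h h0 {IH am nm}.
  move=> e uh; rewrite -e.
  by have -> : h - u = (h.-1 - u).+1 by lia.
Qed.

Lemma size_up_altitudes m h p : strip_path m h p ->
  size p = (size (up_altitudes h p)).*2 + h.
Proof.
elim: p h => [|[] p IH] h /=; first by move/eqP=> ->.
- by move=> /andP[_ /IH ->]; lia.
- by move=> /andP[h0 /IH ->]; lia.
Qed.

Local Open Scope ring_scope.

(** * Altitudes and the shape of rushed paths *)

Lemma altitude0 p : altitude p 0 = 0.
Proof. by rewrite /altitude take0. Qed.

Lemma altitude_nil i : altitude [::] i = 0.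
Proof. by []. Qed.

Lemma altitude_cons b p i :
  altitude (b :: p) i.+1 = (if b then 1 else -1) + altitude p i.
Proof. by rewrite /altitude; case: b => /=; lia. Qed.

Lemma altitude_cat s p i : altitude (s ++ p) (size s + i) =
  altitude s (size s) + altitude p i.
Proof. by rewrite /altitude takeD take_size_cat // drop_size_cat // !count_cat take_size; lia. Qed.

Lemma altitude_ups h p i : (i <= h)%N -> altitude (nseq h true ++ p) i = i%:Z.
Proof.
elim: h i p => [|h IH] [|i] p //= ih; rewrite ?altitude0 //.
by rewrite altitude_cons IH //; lia.
Qed.

Lemma altitude_after_ups h p i : altitude (nseq h true ++ p) (h + i) = h%:Z + altitude p i.
Proof.
have := altitude_cat (nseq h true) p i; rewrite size_nseq => ->.
by rewrite -[nseq h true]cats0 altitude_ups.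
Qed.

Lemma strip_path_altitude m a p : strip_path m a p -> (a <= m)%N ->
  (forall i, 0 <= a%:Z + altitude p i <= m%:Z) /\ a%:Z + altitude p (size p) = 0.
Proof.
elim: p a => [|[] p IH] a /=.
- by move=> /eqP -> _; split=> // i; rewrite altitude_nil.
- move=> /andP[am sp] _; have [b e] := IH _ sp am; split=> [[|i]|]; rewrite ?altitude0 ?altitude_cons; try lia.
  by have := b i; lia.
- move=> /andP[a0 sp] am; have [|b e] := IH _ sp; first lia.
  split=> [[|i]|]; rewrite ?altitude0 ?altitude_cons; try lia.
  by have := b i; lia.
Qed.

(** Altitudes change by one, so a path starting at most at [m] and avoiding [m.+1] never exceeds
    [m]. *)
Lemma below_strip_path m a p : (a <= m)%N ->
  (forall i, (i <= size p)%N -> 0 <= a%:Z + altitude p i) ->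
  (forall i, (i <= size p)%N -> a%:Z + altitude p i != m.+1%:Z) ->
  a%:Z + altitude p (size p) = 0 -> strip_path m a p.
Proof.
elim: p a => [|b p IH] a am pos avoid /=; first by rewrite altitude_nil; lia.
have p1 := pos 1%N isT; have a1 := avoid 1%N isT.
rewrite altitude_cons altitude0 in p1 a1; rewrite altitude_cons => e.
case: b pos avoid p1 a1 e => pos avoid p1 a1 e; apply/andP; split; try lia.
- by apply: IH; [lia | move=> i ip; have := pos i.+1 ip | 
    move=> i ip; have := avoid i.+1 ip | ]; rewrite ?altitude_cons; lia.
- by apply: IH; [lia | move=> i ip; have := pos i.+1 ip | 
    move=> i ip; have := avoid i.+1 ip | ]; rewrite ?altitude_cons; lia.
Qed.

(** Excludes, in a rushed path, an up-step right after the run that reaches [h]: the path could not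
    return to 0. *)
Lemma above_stays_above h a p : (h < a)%N ->
  (forall i, (i <= size p)%N -> a%:Z + altitude p i != h%:Z) ->
  h%:Z < a%:Z + altitude p (size p).
Proof.
elim: p a => [|b p IH] a ha avoid /=; first by rewrite altitude_nil; lia.
have a1 := avoid 1%N isT; rewrite altitude_cons altitude0 in a1; rewrite altitude_cons.
suff : h%:Z < (if b then a.+1 else a.-1)%:Z + altitude p (size p) by case: b {avoid} a1; lia.
apply: IH; first by case: b {avoid} a1; lia.
by move=> i ip; have := avoid i.+1 ip; rewrite altitude_cons; case: b {avoid} a1; lia.
Qed.

Definition path_of_code (k : nat) (v : seq nat) : seq bool :=
  nseq k.+1 true ++ false :: path_of k v.

Definition is_code (n k : nat) (v : seq nat) : bool :=
  [&& (0 < k)%N, (size v + k == n)%N, all (gtn k) v & normal v].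

Lemma altitude_rushed k q i :
  altitude (nseq k.+1 true ++ false :: q) i =
  if (i <= k.+1)%N then i%:Z else k%:Z + altitude q (i - k.+2).
Proof.
case: leqP => ik; first by rewrite altitude_ups.
have -> : i = (k.+1 + (i - k.+2).+1)%N by lia.
rewrite altitude_after_ups altitude_cons.
have -> : (k.+1 + (i - k.+2).+1 - k.+2 = i - k.+2)%N by lia.
lia.
Qed.

Lemma rushed_shape m (p : (2 * m).-tuple bool) : dyck p -> rushed p ->
  exists k q, tval p = nseq k.+1 true ++ false :: q /\ strip_path k k q.
Proof.
have sp := size_tuple p.
move=> /andP[/forallP pos /eqP e0] /existsP[[h hm]] /= /and3P[h0 /eqP th /forallP av].
case: h hm h0 th av => [//|k] km _ th av; exists k.
have Ep := cat_take_drop k.+1 p; rewrite th in Ep.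
have {}pos i : (i <= 2 * m)%N -> 0 <= altitude p i.
  by move=> im; have := pos (inord i); rewrite inordK.
have {}av i : (i <= 2 * m)%N -> (k.+1 < i)%N -> altitude p i != k.+1%:Z.
  by move=> im; have /implyP := av (inord i); rewrite inordK.
have sd : size (drop k.+1 p) = (2 * m - k.+1)%N by rewrite size_drop sp.
move: (drop k.+1 p) Ep sd => [|b q] Ep sd.
  (* The initial run cannot be the whole path, which would then end at [k.+1]. *)
  by exfalso; rewrite /= in sd; move: e0; rewrite -Ep altitude_ups; lia.
have alt i : altitude p (k.+1 + i.+1) = k.+1%:Z + (if b then 1 else -1) + altitude q i.
  by rewrite -Ep altitude_after_ups altitude_cons; lia.
rewrite /= in sd.
have {}e0 : k.+1%:Z + (if b then 1 else -1) + altitude q (size q) = 0.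
  by rewrite -alt; move: e0; congr (altitude _ _ = _); lia.
have {}pos i : (i <= size q)%N -> 0 <= k.+1%:Z + (if b then 1 else -1) + altitude q i.
  by move=> iq; rewrite -alt; apply: pos; lia.
have {}av i : (i <= size q)%N -> k.+1%:Z + (if b then 1 else -1) + altitude q i != k.+1%:Z.
  by move=> iq; rewrite -alt; apply: av; lia.
case: b Ep {alt} e0 pos av => Ep e0 pos av.
  (* A further up-step would keep the path above [k.+1] until its end at altitude 0. *)
  have := @above_stays_above k.+1 k.+2 q (ltnSn _); rewrite (_ : k.+2%:Z = k.+1%:Z + 1); last lia.
  by move=> /(_ av); lia.
exists q; split=> //; apply: below_strip_path => // [i iq|i iq|].
- by have := pos i iq; lia.
- by have := av i iq; lia.
- lia.
Qed.

Lemma shape_rushed m (p : (2 * m).-tuple bool) k q :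
  tval p = nseq k.+1 true ++ false :: q -> strip_path k k q ->
  [/\ dyck p, rushed p & height p = k.+1].
Proof.
move=> Ep sq; have sp := size_tuple p.
have [b e0] := strip_path_altitude sq (leqnn k).
have alt i : altitude p i = if (i <= k.+1)%N then i%:Z else k%:Z + altitude q (i - k.+2).
  by rewrite Ep altitude_rushed.
have km : (k.+1 + (size q).+1 = 2 * m)%N.
  by rewrite -sp Ep size_cat size_nseq.
have km' : (k.+1 < (2 * m).+1)%N by lia.
split.
- rewrite /dyck; apply/andP; split.
    apply/forallP => i; rewrite alt; case: leqP => // ik.
    by have := b (i - k.+2)%N; lia.
  rewrite alt ifN; last lia.
  by rewrite (_ : 2 * m - k.+2 = size q)%N ?e0 //; lia.
- apply/existsP; exists (Ordinal km').
  apply/and3P; split=> //; first by rewrite Ep take_size_cat ?size_nseq.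
  apply/forallP => i; apply/implyP => /= ki; rewrite alt ifN; last lia.
  by have := b (i - k.+2)%N; lia.
- apply/eqP; rewrite eqn_leq; apply/andP; split.
    apply/bigop.bigmax_leqP => i _; rewrite alt; case: (leqP i k.+1) => ik; first lia.
    by have := b (i - k.+2)%N; lia.
  by apply: (bigop.bigmax_sup (Ordinal km')) => //=; rewrite alt leqnn.
Qed.

Local Close Scope ring_scope.

Lemma card_eq_pred (F : finType) (P : pred F) : ([set x | P x] #= `I_#|P|)%card.
Proof.
rewrite card_eq_sym; have <- : (index^~ (enum P)) @` [set x | P x] = `I_#|P|.
  apply/seteqP; split=> [_ [x Px <-]|j] /=; first by rewrite cardE index_mem mem_enum.
  rewrite cardE => jP; have x0 : F by case: (enum P) jP.
  exists (nth x0 (enum P) j); last by rewrite index_uniq ?enum_uniq.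
  by have := mem_nth x0 jP; rewrite mem_enum.
apply: inj_card_eq => x y; rewrite !inE => Px Py exy.
have mx : x \in enum P by rewrite mem_enum.
have my : y \in enum P by rewrite mem_enum.
by rewrite -(nth_index x mx) exy nth_index.
Qed.

(** For a rushed path the height is the length of the initial run, so dropping one step more also
    removes the down-step after it. *)
Definition code_of m (p : (2 * m).-tuple bool) : nat * seq nat :=
  ((height p).-1, up_altitudes (height p).-1 (drop (height p).+1 p)).

Lemma code_of_shape m (p : (2 * m).-tuple bool) : dyck p -> rushed p ->
  exists k v, [/\ code_of p = (k, v), tval p = path_of_code k v,
    strip_path k k (path_of k v) & up_altitudes k (path_of k v) = v].
Proof.
move=> /rushed_shape H /H [k [q [Ep sq]]]; exists k, (up_altitudes k q).
have [_ _ hp] := shape_rushed Ep sq.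
have [_ [e _]] := up_altitudes_strip sq.
rewrite /path_of_code e; split=> //.
rewrite /code_of hp /= Ep -cat1s catA drop_size_cat //.
by rewrite size_cat size_nseq addn1.
Qed.

(** The filter [Q] on the number of rows lets one bijection serve both the count for a fixed height
    and the total. *)
Lemma codes_card n (Q : pred nat) : 0 < n ->
  ([set c : nat * seq nat | is_code n c.1 c.2 && Q c.1] #=
   `I_#|[pred p : (2 * (n + 1)).-tuple bool | [&& dyck p, rushed p & Q (height p).-1]]|)%card.
Proof.
move=> n0; set P := [pred p | _]; rewrite -(card_eqr (card_eq_pred P)).
have <- : @code_of (n + 1) @` [set p | P p] = [set c | is_code n c.1 c.2 && Q c.1].
  apply/seteqP; split=> [_ [p /and3P[dp rp Qp] <-]|[k v] /= /andP[/and4P[k0 /eqP nv vk sv] Qk]].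
    have [k [v [e Ep sq uv]]] := code_of_shape dp rp.
    have Qk : Q k by move: Qp; have := e; rewrite /code_of => -[-> _].
    have sz := size_tuple p; rewrite Ep size_cat size_nseq /= (size_up_altitudes sq) uv in sz.
    have [am [_ [_ nm]]] := up_altitudes_strip sq; rewrite uv in am nm.
    have nk : (size v + k = n)%N by lia.
    rewrite e /= /is_code Qk am nm nk eqxx !andbT.
    (* If [k = 0], no letter is below [k], so [v] is empty and [n = 0]. *)
    by case: k nk {e Ep Qk} sq uv am sz => // nk; case: v nk nm => //= ; lia.
  have sk : normal (k.-1 :: v).
    by move: vk sv; case: v {nv} => //= u v /andP[uk _] sv; rewrite /normal /= sv andbT; lia.
  have sp := strip_path_of sk k0 vk.
  (* The beginning has [k.+2] steps and the rest [2 * size v + k], together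
     [2 * (size v + k) + 2]. *)
  have szp : size (path_of_code k v) == 2 * (n + 1).
    by rewrite size_cat size_nseq /= (size_up_altitudes sp) path_ofK //; lia.
  pose p := Tuple szp.
  have Ep : tval p = nseq k.+1 true ++ false :: path_of k v by [].
  have [dp rp hp] := shape_rushed Ep sp.
  exists p; first by rewrite /= dp rp hp.
  have := code_of_shape dp rp; rewrite /code_of hp /= -cat1s catA drop_size_cat.
    by rewrite path_ofK.
  by rewrite size_cat size_nseq addn1.
apply: inj_card_eq => p q; rewrite !inE.
move=> /and3P[dp rp _] /and3P[dq rq _].
have [k [v [-> Ep _ _]]] := code_of_shape dp rp.
have [l [w [-> Eq _ _]]] := code_of_shape dq rq.
by move=> [kl vw]; apply: val_inj; rewrite /= Ep Eq kl vw.
Qed.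

Local Open Scope ring_scope.

(** * Segments *)

Section Lines.
Variable R : realType.
Implicit Types (r B : rect R) (d : bool) (S : set (R * R)).

(** The Boolean [d] lets statements about sides and segments be proved once for both directions. *)
Definition lo d r := if d then yl r else xl r.
Definition hi d r := if d then yr r else xr r.

Definition pt d (c t : R) : R * R := if d then (c, t) else (t, c).

(* [line true] is vertical and [line false] horizontal; [lo d] and [hi d] are
   measured along it, [lo (~~ d)] and [hi (~~ d)] across it. *)
Definition line d (c a b : R) := if d then vert_line c a b else horiz_line c a b.

Lemma lo_lt_hi d r : lo d r < hi d r.
Proof. by case: d; [exact: yl_lt_yr|exact: xl_lt_xr]. Qed.

Lemma pt_onto d p : exists c t, p = pt d c t.
Proof. by case: d p => -[x y]; [exists x, y|exists y, x]. Qed.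

Lemma in_line d c a b e t : line d c a b (pt d e t) <-> e = c /\ a <= t <= b.
Proof.
case: d; rewrite /line /vert_line /horiz_line /= ?set_itvE /=.
  by split=> -[-> /=]; rewrite ?in_itv.
by split=> -[] /=; rewrite ?in_itv.
Qed.

Lemma in_rect d r c t : rect_set r (pt d c t) <->
  lo (~~ d) r <= c <= hi (~~ d) r /\ lo d r <= t <= hi d r.
Proof. by case: d; rewrite /rect_set /=; split=> -[] /=; rewrite !in_itv. Qed.

Lemma in_interior d r c t : rect_interior r (pt d c t) <->
  lo (~~ d) r < c < hi (~~ d) r /\ lo d r < t < hi d r.
Proof. by case: d; rewrite /rect_interior /=; split=> -[] /=; rewrite !in_itv. Qed.

Lemma straightP S : straight S <-> exists d c a b, a < b /\ S = line d c a b.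
Proof.
split=> [[]|].
- by move=> [c [a [b [ab ->]]]]; exists true, c, a, b.
- by move=> [c [a [b [ab ->]]]]; exists false, c, a, b.
- by move=> [[] [c [a [b [ab ->]]]]]; [left|right]; exists c, a, b.
Qed.

Lemma is_sideP r S : is_side r S <-> exists d c,
  ((lo (~~ d) r == c) || (hi (~~ d) r == c)) /\ S = line d c (lo d r) (hi d r).
Proof.
split=> [[] ->|].
- by exists true, (xl r); rewrite /= eqxx.
- by exists true, (xr r); rewrite /= eqxx orbT.
- by exists false, (yl r); rewrite /= eqxx.
- by exists false, (yr r); rewrite /= eqxx orbT.
by move=> [[] [c [/orP[]/eqP <- ->]]]; [constructor 1|constructor 2|constructor 3|constructor 4].
Qed.

Lemma line_sub d c a b e a' b' : a <= b ->
  line d c a b `<=` line d e a' b' -> [/\ c = e, a' <= a & b <= b'].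
Proof.
move=> ab sub.
have /sub/in_line[-> /andP[? _]] : line d c a b (pt d c a) by apply/in_line; rewrite lexx ab.
have /sub/in_line[_ /andP[_ ?]] : line d c a b (pt d c b) by apply/in_line; rewrite lexx ab.
by [].
Qed.

Lemma line_sub_dir d d' c a b e a' b' : a < b ->
  line d c a b `<=` line d' e a' b' -> d = d'.
Proof.
move=> ab sub; apply/eqP; case: eqP => // dd'; exfalso.
have {}dd' : d = ~~ d' by case: d d' dd' {sub} => -[].
have pE t : pt d c t = pt d' t c by rewrite dd'; case: d' {sub dd'}.
have /sub : line d c a b (pt d c a) by apply/in_line; rewrite lexx ltW.
have /sub : line d c a b (pt d c b) by apply/in_line; rewrite lexx ltW.
by rewrite !pE => /in_line[eb _] /in_line[ea _]; rewrite ea eb ltxx in ab.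
Qed.

Lemma straight_line d c a b : straight (line d c a b) <-> a < b.
Proof.
rewrite straightP; split=> [[d' [e [a' [b' [ab E]]]]]|ab]; last by exists d, c, a, b.
have sub : line d' e a' b' `<=` line d c a b by rewrite E.
have dd := line_sub_dir ab sub; rewrite dd in sub.
by have [_ h1 h2] := line_sub (ltW ab) sub; lra.
Qed.

(** The one-dimensional form of a union of sides: the interval is covered by those intervals of the
    family that it contains. *)
Definition tiled_itv (I : finType) (P : pred I) (a b : I -> R) (z w : R) :=
  z < w /\ forall t, z <= t <= w ->
    exists i, [/\ P i, z <= a i, b i <= w & a i <= t <= b i].

(** The ends of a tiled interval are ends of members of the family, so only finitely many intervals
    compete and a longest one around [i0] exists. *)
Lemma max_tiled_itv (I : finType) (P : pred I) (a b : I -> R) (i0 : I) :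
  (forall i, a i < b i) -> P i0 ->
  exists z w, [/\ tiled_itv P a b z w, z <= a i0, b i0 <= w &
    forall z' w', tiled_itv P a b z' w' -> z' <= z -> w <= w' -> z' = z /\ w' = w].
Proof.
move=> ab Pi0.
pose C (p : I * I) := `[< [/\ tiled_itv P a b (a p.1) (b p.2), a p.1 <= a i0 & b i0 <= b p.2] >].
have C0 : C (i0, i0).
  by apply/asboolP; split=> //=; split=> // t tab; exists i0; split.
case: (arg_maxP (fun p => b p.2 - a p.1) C0) => -[p q] /asboolP /= [Tpq pi qi] max.
exists (a p), (b q); split=> // z w Tzw zp qw.
have [zw H] := Tzw.
have [|i [_ zi _ iz]] := H z; first by rewrite lexx ltW.
have [|j [_ _ jw wj]] := H w; first by rewrite lexx ltW.
have ei : z = a i by lra.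
have ej : w = b j by lra.
have /max /= : C (i, j) by apply/asboolP; rewrite /= -ei -ej; split=> //; lra.
by rewrite -ei -ej => ?; split; lra.
Qed.

Section Tiles.
Variables (n : nat) (T : 'I_n -> rect R).

Definition on_line d (c : R) (i : 'I_n) := (lo (~~ d) (T i) == c) || (hi (~~ d) (T i) == c).

Definition tiled_line d c :=
  tiled_itv (on_line d c) (fun i => lo d (T i)) (fun i => hi d (T i)).

(** A side contained in a line has the direction of that line, so transversal sides cannot occur in
    the union. Conversely, all sides inside the line are taken. *)
Lemma union_of_sides_line d c a b : a < b ->
  union_of_sides T (line d c a b) <-> tiled_line d c a b.
Proof.
move=> ab; split=> [[F [Fs E]]|[_ H]].
  split=> // t abt.
  have : line d c a b (pt d c t) by apply/in_line.
  rewrite {1}E => -[s Fss st].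
  have [i /is_sideP[d' [e [Pi sE]]]] := Fs s Fss.
  have sub : s `<=` line d c a b by rewrite E => p sp; exists s.
  rewrite sE in sub st.
  have dd := line_sub_dir (lo_lt_hi d' (T i)) sub; rewrite {}dd in sub st Pi.
  have [ec ai ib] := line_sub (ltW (lo_lt_hi d (T i))) sub; rewrite -{}ec in st *.
  by exists i; split=> //; have /in_line[_] := st.
exists [set s | (exists i, is_side (T i) s) /\ s `<=` line d c a b]; split; first by move=> s [].
apply/seteqP; split=> [p|p [s [_ sub] sp]]; last exact: sub.
have [e [t ->]] := pt_onto d p => /in_line[-> /H [i [Pi ai ib it]]].
exists (line d c (lo d (T i)) (hi d (T i))); last exact/in_line.
split; first by exists i; apply/is_sideP; exists d, c.
move=> q; have [e' [t' ->]] := pt_onto d q => /in_line[-> tt]; apply/in_line; split=> //; lra.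
Qed.

Lemma segment_line B d c a b : segment B T (line d c a b) <->
  [/\ tiled_line d c a b, ~ line d c a b `<=` rect_boundary B &
    forall z w, tiled_line d c z w -> z <= a -> b <= w -> z = a /\ w = b].
Proof.
split=> [[/straight_line ab U nB max]|[U nB max]].
  split=> //; first exact/union_of_sides_line.
  move=> z w Uzw za bw; have [zw _] := Uzw.
  have E : line d c z w = line d c a b.
    apply: max; [exact/straight_line|exact/union_of_sides_line|].
    move=> q; have [e [t ->]] := pt_onto d q => /in_line[-> tt]; apply/in_line; split=> //; lra.
  have sub : line d c z w `<=` line d c a b by rewrite E.
  by have [_ ? ?] := line_sub (ltW zw) sub; split; lra.
have [ab _] := U; split=> //; [exact/straight_line|exact/union_of_sides_line|].
move=> S' /straightP[d' [e [z [w [zw ->]]]]] U' sub.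
have dd := line_sub_dir ab sub; rewrite -dd in sub U' *.
have [ec za bw] := line_sub (ltW ab) sub; rewrite -ec in U' *.
by move/(union_of_sides_line d c zw) : U' => /max [||-> ->].
Qed.

Variable B : rect R.
Hypothesis T_cover : \bigcup_i rect_set (T i) = rect_set B.

Lemma tile_bounds d i : lo d B <= lo d (T i) /\ hi d (T i) <= hi d B.
Proof.
have in_B p : rect_set (T i) p -> rect_set B p by rewrite -T_cover => ?; exists i.
have l t := lo_lt_hi t (T i).
have /in_B/in_rect[_ /andP[? _]] : rect_set (T i) (pt d (lo (~~ d) (T i)) (lo d (T i))).
  by apply/in_rect; rewrite !lexx !ltW.
have /in_B/in_rect[_ /andP[_ ?]] : rect_set (T i) (pt d (lo (~~ d) (T i)) (hi d (T i))).
  by apply/in_rect; rewrite !lexx !ltW.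
by [].
Qed.

Lemma tiled_line_bounds d c a b : tiled_line d c a b -> lo d B <= a /\ b <= hi d B.
Proof.
move=> [ab H].
have [|i [_ ia _ ai]] := H a; first by rewrite lexx ltW.
have [|j [_ _ jb bj]] := H b; first by rewrite lexx ltW.
by have [? _] := tile_bounds d i; have [_ ?] := tile_bounds d j; split; lra.
Qed.

Lemma line_not_boundary d c a b : tiled_line d c a b ->
  ~ line d c a b `<=` rect_boundary B <-> lo (~~ d) B < c < hi (~~ d) B.
Proof.
move=> U; have [la bh] := tiled_line_bounds U; have [ab H] := U; split=> [nB|cB sub].
  have [|i [Pi _ _ _]] := H a; first by rewrite lexx ltW.
  have [? ?] := tile_bounds (~~ d) i; have ? := lo_lt_hi (~~ d) (T i).
  have /andP[c1 c2] : lo (~~ d) B <= c <= hi (~~ d) B by case/orP: Pi => /eqP <-; lra.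
  rewrite !lt_neqAle (eq_sym _ c) c1 c2 !andbT; apply/andP; split; apply/eqP => e;
   case: nB => q; have [e' [t ->]] := pt_onto d q => /in_line[-> tt]; split;
   [apply/in_rect|move/in_interior=> []|apply/in_rect|move/in_interior=> []]; lra.
(* The ends of the line may lie on the boundary of [B]; its midpoint does not. *)
have /sub : line d c a b (pt d c ((a + b) / 2)) by apply/in_line; split=> //; lra.
by move=> [_]; apply; apply/in_interior; split=> //; lra.
Qed.

Lemma segment_lineE d c a b : segment B T (line d c a b) <->
  [/\ tiled_line d c a b, lo (~~ d) B < c < hi (~~ d) B &
    forall z w, tiled_line d c z w -> z <= a -> b <= w -> z = a /\ w = b].
Proof.
rewrite segment_line; split=> -[U h max]; split=> //; exact/(line_not_boundary U).
Qed.

Lemma segment_exists d c i : on_line d c i -> lo (~~ d) B < c < hi (~~ d) B ->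
  exists a b, [/\ segment B T (line d c a b), a <= lo d (T i) & hi d (T i) <= b].
Proof.
move=> Pi cB.
have [a [b [U ai bi max]]] := @max_tiled_itv _ (on_line d c) (fun i => lo d (T i))
  (fun i => hi d (T i)) i (fun i => lo_lt_hi d (T i)) Pi.
by exists a, b; split=> //; apply/segment_lineE.
Qed.

End Tiles.
End Lines.

(** * Tilings with full horizontal segments *)

Lemma itv_common (R : realType) (a b c d : R) : a < b -> c < d -> a < d -> c < b ->
  exists t, a < t < b /\ c < t < d.
Proof.
move=> ab cd ad cb; exists ((Num.max a c + Num.min b d) / 2).
by rewrite /Num.max /Num.min; case: ifP; case: ifP; lra.
Qed.

Lemma just_above (R : realType) (s : seq R) (x m : R) : x < m ->
  exists x', x < x' < m /\ forall z, z \in s -> x < z -> x' < z.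
Proof.
move=> xm; elim: s => [|a s [x' [xx' H]]]; first by exists ((x + m) / 2); split=> //; lra.
case: (ltP x a) => xa; last first.
  by exists x'; split=> // z; rewrite inE => /orP[/eqP -> |]; [lra|exact: H].
have [t [t1 t2]] : exists t, x < t < x' /\ x < t < a by apply: itv_common; lra.
exists t; split; first lra.
by move=> z; rewrite inE => /orP[/eqP -> |zs xz]; [lra|have := H z zs xz; lra].
Qed.

Section Tilings.
Variables (R : realType) (B : rect R) (n : nat) (T : rectangulation B n).

Let lx i := lo_lt_hi false (T i).
Let ly i := lo_lt_hi true (T i).
Let bx i := tile_bounds (tile_cover T) false i.
Let by' i := tile_bounds (tile_cover T) true i.

Lemma tile_sep i j : i != j ->
  xr (T i) <= xl (T j) \/ xr (T j) <= xl (T i) \/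
  yr (T i) <= yl (T j) \/ yr (T j) <= yl (T i).
Proof.
move=> ij; apply: contrapT => /not_orP[/negP h1] /not_orP[/negP h2] /not_orP[/negP h3 /negP h4].
rewrite -!ltNge in h1 h2 h3 h4.
have [x [xi xj]] := itv_common (lx i) (lx j) h2 h1.
have [y [yi yj]] := itv_common (ly i) (ly j) h4 h3.
have : (rect_interior (T i) `&` rect_interior (T j)) (pt true x y).
  by split; apply/in_interior.
by rewrite tile_disjoint.
Qed.

(** Half-open tiles still cover. The point is moved up and to the right, but not past any left or
    bottom side beyond it; a tile containing the moved point then starts no later than the original
    one and ends strictly after it. *)
Lemma tile_at x y : xl B <= x < xr B -> yl B <= y < yr B ->
  exists i, xl (T i) <= x < xr (T i) /\ yl (T i) <= y < yr (T i).
Proof.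
move=> /andP[x1 x2] /andP[y1 y2].
have [x' [/andP[xx' x'2] Hx]] := just_above (map (fun i => xl (T i)) (enum 'I_n)) x2.
have [y' [/andP[yy' y'2] Hy]] := just_above (map (fun i => yl (T i)) (enum 'I_n)) y2.
have : rect_set B (pt true x' y') by apply/in_rect; rewrite /=; lra.
rewrite -(tile_cover T) => -[i _ /in_rect /= [/andP[? ?] /andP[? ?]]]; exists i.
have ? : xl (T i) <= x.
  rewrite leNgt; apply/negP => /Hx; rewrite map_f ?mem_enum // => /(_ isT); lra.
have ? : yl (T i) <= y.
  rewrite leNgt; apply/negP => /Hy; rewrite map_f ?mem_enum // => /(_ isT); lra.
by lra.
Qed.

Lemma contactP i j : i != j -> contact T i j <->
  exists d, (hi (~~ d) (T i) = lo (~~ d) (T j) \/ hi (~~ d) (T j) = lo (~~ d) (T i)) /\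
    lo d (T i) < hi d (T j) /\ lo d (T j) < hi d (T i).
Proof.
move=> ij; split.
  move=> [S [/straightP[d [c [a [b [ab ->]]]]] Si Sj]].
  have sub k : line d c a b `<=` rect_boundary (T k) ->
      lo (~~ d) (T k) <= c <= hi (~~ d) (T k) /\ lo d (T k) <= a /\ b <= hi d (T k).
    move=> Sk.
    have /Sk[/in_rect[? ?] _] : line d c a b (pt d c a) by apply/in_line; rewrite lexx ltW.
    have /Sk[/in_rect[? ?] _] : line d c a b (pt d c b) by apply/in_line; rewrite lexx ltW.
    lra.
  have [ci abi] := sub i Si; have [cj abj] := sub j Sj.
  exists d; split; last lra.
  (* The tiles overlap along [d], so disjointness must separate them across [d], where both meet the
     coordinate [c]. *)
  by have := tile_sep ij; case: d ci cj abi abj {Si Sj sub} => /=; lra.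
move=> [d [E [h1 h2]]].
have [a [b [ab [ia ja ib jb]]]] : exists a b, a < b /\
    [/\ lo d (T i) <= a, lo d (T j) <= a, b <= hi d (T i) & b <= hi d (T j)].
  have li := lo_lt_hi d (T i); have lj := lo_lt_hi d (T j).
  exists (Num.max (lo d (T i)) (lo d (T j))), (Num.min (hi d (T i)) (hi d (T j))).
  by rewrite /Num.max /Num.min; case: ifP; case: ifP; split; try split; lra.
pose c := if hi (~~ d) (T i) == lo (~~ d) (T j) then hi (~~ d) (T i) else lo (~~ d) (T i).
have ci : on_line T d c i by rewrite /on_line /c; case: ifP; rewrite eqxx ?orbT.
have cj : on_line T d c j.
  rewrite /on_line /c; case: ifP => [/eqP ->|/eqP ne]; first by rewrite eqxx.
  by case: E => [//|->]; rewrite eqxx orbT.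
have sub k : on_line T d c k -> lo d (T k) <= a -> b <= hi d (T k) ->
    line d c a b `<=` rect_boundary (T k).
  move=> ck ka bk p; have [e [t ->]] := pt_onto d p => /in_line[-> tt].
  have lk := lo_lt_hi (~~ d) (T k); split; first by apply/in_rect; case/orP: ck => /eqP; lra.
  by move/in_interior => [+ _]; case/orP: ck => /eqP; lra.
by exists (line d c a b); split; [exact/straight_line|exact: sub|exact: sub].
Qed.

Section Full.
Hypothesis full : full_horizontals T.

Lemma full_line y i : on_line T false y i -> yl B < y < yr B ->
  segment B T (line false y (xl B) (xr B)).
Proof.
move=> yi yB; have [a [b [sg _ _]]] := segment_exists (tile_cover T) yi yB.
have [_ _ _ _] := sg.
have ab : a < b by move/(segment_lineE (tile_cover T)): sg => [[]].
have [|z E] := full (S := line false y a b); first by split=> //; exists y, a, b.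
have zE : y = z by have [] := @line_sub _ false y a b z (xl B) (xr B) (ltW ab) ltac:(by rewrite E).
by rewrite E -zE in sg.
Qed.

(** The full segment at height [y] is made of sides, one of which passes the middle of tile [i]. The
    tile with that side would overlap tile [i]. *)
Lemma no_cross y i j : on_line T false y j -> ~ (yl (T i) < y < yr (T i)).
Proof.
move=> yj /andP[iy yi]; have := by' i; rewrite /= => -[B1 B2].
have yB : yl B < y < yr B by lra.
have /(segment_lineE (tile_cover T)) [[_ U] _ _] := full_line yj yB.
have := bx i; have := lx i; rewrite /= => l1 -[B3 B4].
have [|m [ym _ _ /= mx]] := U ((xl (T i) + xr (T i)) / 2); first lra.
have im : i != m by apply/eqP => im; move: ym; rewrite -im => /orP[]/eqP /=; lra.
have := tile_sep im; have := ly m; have := lx m; case/orP: ym => /eqP /=; lra.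
Qed.

(** This yields the rows: by [no_cross], neither vertical range has an end strictly inside the
    other. *)
Lemma row_eq i j : yl (T i) < yr (T j) -> yl (T j) < yr (T i) ->
  yl (T i) = yl (T j) /\ yr (T i) = yr (T j).
Proof.
move=> h1 h2.
have n1 := @no_cross (yl (T j)) i j; have n2 := @no_cross (yl (T i)) j i.
have n3 := @no_cross (yr (T j)) i j; have n4 := @no_cross (yr (T i)) j i.
rewrite /on_line /= !eqxx ?orbT in n1 n2 n3 n4.
move: (n1 isT) (n2 isT) (n3 isT) (n4 isT) => {n1 n2 n3 n4} /negP n1 /negP n2 /negP n3 /negP n4.
have := ly i; have := ly j; rewrite /= => lj li.
rewrite !negb_and -!leNgt in n1 n2 n3 n4.
by case/orP: n1; case/orP: n2; case/orP: n3; case/orP: n4; lra.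
Qed.

Lemma same_yr i j : yl (T i) = yl (T j) -> yr (T i) = yr (T j).
Proof. by have := ly i; have := ly j; rewrite /= => lj li e; have [] := @row_eq i j; lra. Qed.

Lemma row_sep i j : i != j -> yl (T i) = yl (T j) ->
  xr (T i) <= xl (T j) \/ xr (T j) <= xl (T i).
Proof.
move=> ij e; have := tile_sep ij; have := same_yr e; have := ly i; have := ly j.
by rewrite /=; lra.
Qed.

Lemma row_inj i j : yl (T i) = yl (T j) -> xl (T i) = xl (T j) -> i = j.
Proof.
move=> ey ex; apply/eqP; apply: contrapT => /negP ij.
by have := row_sep ij ey; have := lx i; have := lx j; rewrite /=; lra.
Qed.

Lemma row_at i x : xl B <= x < xr B ->
  exists j, [/\ yl (T j) = yl (T i), xl (T j) <= x & x < xr (T j)].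
Proof.
move=> xB; have := by' i; have := ly i; rewrite /= => li [B1 B2].
have [|j [/andP[? ?] yj]] := @tile_at x (yl (T i)) xB; first lra.
by exists j; split=> //; have [] := @row_eq i j; lra.
Qed.

Lemma next_row_at i x : yr (T i) < yr B -> xl B <= x < xr B ->
  exists j, [/\ yl (T j) = yr (T i), xl (T j) <= x & x < xr (T j)].
Proof.
move=> iB xB; have := by' i; have := ly i; rewrite /= => li [B1 B2].
have [|j [/andP[? ?] /andP[y1 y2]]] := @tile_at x (yr (T i)) xB; first lra.
exists j; split=> //; have := @no_cross (yr (T i)) j i.
rewrite /on_line /= eqxx orbT => /(_ isT) /negP; rewrite negb_and -!leNgt => /orP[]; lra.
Qed.

Lemma next_in_row i : xr (T i) < xr B ->
  exists j, yl (T j) = yl (T i) /\ xl (T j) = xr (T i).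
Proof.
move=> iB; have := bx i; have := lx i; rewrite /= => li [B1 B2].
have [|j [ej j1 j2]] := @row_at i (xr (T i)); first lra.
exists j; split=> //; have ij : i != j by apply/eqP => ij; rewrite -ij in j2; lra.
by have := row_sep ij (esym ej); lra.
Qed.

(** A longer vertical segment would cross the full horizontal segment at the top or bottom of tile
    [i], against genericity. *)
Lemma vertical_segment_row x y1 y2 i : segment B T (line true x y1 y2) ->
  y1 <= yl (T i) -> yr (T i) <= y2 -> y1 = yl (T i) /\ y2 = yr (T i).
Proof.
move=> sg h1 h2; have /(segment_lineE (tile_cover T)) [U /= xB _] := sg.
have := tiled_line_bounds (tile_cover T) U; rewrite /= => -[B1 B2].
have := ly i; rewrite /= => li.
have cross y : on_line T false y i -> ~ (y1 < y < y2).
  move=> yi yy; have := tile_generic sg (full_line yi _); apply=> //; lra.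
have := cross (yl (T i)); have := cross (yr (T i)).
rewrite /on_line /= !eqxx orbT => /(_ isT)/negP c1 /(_ isT)/negP c2.
by rewrite !negb_and -!leNgt in c1 c2; case/orP: c1; case/orP: c2; lra.
Qed.

(* Otherwise the vertical segment through both cuts would cross the horizontal
   segment between their rows. *)
Lemma cuts_differ i j : yr (T i) = yl (T j) -> xl (T i) = xl (T j) -> xl (T i) = xl B.
Proof.
move=> ey ex; have := bx i; have := lx i; rewrite /= => l1 [B1 B2].
apply: contrapT => /eqP xi.
have xB : xl B < xl (T i) < xr B by rewrite lt_neqAle eq_sym xi B1; lra.
have ii : on_line T true (xl (T i)) i by rewrite /on_line /= eqxx.
have [a [b [sg ai ib]]] := segment_exists (tile_cover T) ii xB.
have [Ea Eb] := vertical_segment_row sg ai ib.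
have /(segment_lineE (tile_cover T)) [[ab U] _ max] := sg.
have := ly i; have := ly j; rewrite /= => lj li.
have [|||_] := max a (yr (T j)); try lra.
split; first lra; move=> t tt; case: (leP t b) => tb.
  by have [|m [? /= ? ? ?]] := U t; [lra|exists m; split=> //=; lra].
by exists j; rewrite /on_line /= ex eqxx; split=> //; lra.
Qed.

Lemma right_stepP i j : right_step T i j <-> xr (T i) = xl (T j) /\ yl (T i) = yl (T j).
Proof.
have := ly i; have := ly j; rewrite /= => lj li; split.
  move=> [S [[sg [x [y1 [y2 [y12 SE]]]]] Si Sj]]; rewrite SE in sg Si Sj.
  have [ex ai bi] := @line_sub _ true _ _ _ x y1 y2 (ltW li) Si.
  have [ex' aj bj] := @line_sub _ true _ _ _ x y1 y2 (ltW lj) Sj.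
  have [e1 _] := @vertical_segment_row x y1 y2 i sg ai bi.
  have [e2 _] := @vertical_segment_row x y1 y2 j sg aj bj.
  by split; lra.
move=> [ex ey].
have := lx i; have := lx j; have := bx i; have := bx j; rewrite /= => ? ? lj' li'.
have jj : on_line T true (xr (T i)) i by rewrite /on_line /= eqxx orbT.
have [|a [b [sg ai bi]]] := segment_exists (tile_cover T) jj; first by rewrite /=; lra.
rewrite /= in ai bi.
exists (line true (xr (T i)) a b); split.
- by split=> //; exists (xr (T i)), a, b; split=> //; lra.
- by move=> q; have [e [t ->]] := pt_onto true q => /(@in_line _ true)[-> ?]; apply/in_line; split=> //; lra.
- have := same_yr ey => ey'.
  by move=> q; have [e [t ->]] := pt_onto true q => /(@in_line _ true)[-> ?]; apply/in_line; split=> //; lra.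
Qed.

(** The segment between two rows is full, so it links every tile of the lower row to every tile of
    the upper one, whatever their abscissas. *)
Lemma above_stepP i j : above_step T i j <-> yr (T i) = yl (T j).
Proof.
have := lx i; have := lx j; rewrite /= => lj li; split.
  move=> [S [[sg [y [x1 [x2 [x12 SE]]]]] Si Sj]]; rewrite SE in Si Sj.
  have [-> _ _] := @line_sub _ false _ _ _ y x1 x2 (ltW li) Si.
  by have [-> _ _] := @line_sub _ false _ _ _ y x1 x2 (ltW lj) Sj.
move=> e; have := ly i; have := ly j; have := by' i; have := by' j; rewrite /= => Bj Bi lj' li'.
have := bx i; have := bx j; rewrite /= => Bj' Bi'.
have sg : segment B T (line false (yr (T i)) (xl B) (xr B)).
  by apply: (@full_line _ i); [rewrite /on_line /= eqxx orbT|lra].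
exists (line false (yr (T i)) (xl B) (xr B)); split.
- by split=> //; exists (yr (T i)), (xl B), (xr B); split=> //; exact: xl_lt_xr.
- by move=> q; have [e' [t ->]] := pt_onto false q => /(@in_line _ false)[-> ?]; apply/in_line; split=> //; lra.
- by move=> q; have [e' [t ->]] := pt_onto false q => /(@in_line _ false)[-> ?]; apply/in_line; split=> //; lra.
Qed.

Lemma right_ofP i j : right_of T i j <-> yl (T i) = yl (T j) /\ xl (T i) <= xl (T j).
Proof.
split.
  move=> /connectP[p + ->]; elim: p i => [|m p IH] i /=; first by rewrite lexx.
  move=> /andP[/asboolP/right_stepP[e1 e2] /IH[e3 le]].
  by have := lx i; rewrite /= e2; split=> //; lra.
(* Induction on the number of tiles starting further right than tile [i]; the chain advances to the
   next tile of the row. *)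
move=> [ey]; move: {2}(#|[pred m | xl (T i) < xl (T m)]|) (leqnn #|[pred m | xl (T i) < xl (T m)]|) => N.
elim: N i ey => [|N IH] i ey card ij.
  have : xl (T j) <= xl (T i).
    by rewrite leNgt; apply/negP => lt; move: card; rewrite leqn0 => /eqP/card0_eq/(_ j); rewrite inE lt.
  by move=> ji; rewrite (@row_inj i j) ?/right_of ?connect0 //; lra.
case: (eqVneq i j) => [->|nij]; first exact: connect0.
have := lx i; have := lx j; have := bx j; rewrite /= => Bj lj li.
have ij' : xr (T i) <= xl (T j) by have := row_sep nij ey; lra.
have [|m [em mx]] := @next_in_row i; first lra.
apply: (@connect_trans _ _ m); first by apply: connect1; apply/asboolP/right_stepP.
apply: IH; [by rewrite em| |lra].
rewrite -ltnS; apply: leq_trans card; apply: proper_card; apply/properP; split.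
  by apply/fintype.subsetP => q; rewrite !inE; lra.
by exists m; rewrite !inE; lra.
Qed.

Lemma aboveP i j : above T i j <-> i = j \/ yl (T i) < yl (T j).
Proof.
split.
  move=> /connectP[p + ->]; elim: p i => [|m p IH] i /=; first by left.
  move=> /andP[/asboolP/above_stepP e1 /IH H]; right.
  by have := ly i; rewrite /=; case: H => [<-|]; lra.
case=> [->|]; first exact: connect0.
(* Induction on the number of tiles starting higher than tile [i]; the chain advances to a tile of
   the next row. *)
move: {2}(#|[pred m | yl (T i) < yl (T m)]|) (leqnn #|[pred m | yl (T i) < yl (T m)]|) => N.
elim: N i => [|N IH] i card ij.
  by move: card; rewrite leqn0 => /eqP/card0_eq/(_ j); rewrite inE ij.
have := ly i; have := ly j; have := by' j; rewrite /= => Bj lj li.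
have ij' : yr (T i) <= yl (T j) by rewrite leNgt; apply/negP => ?; have [] := @row_eq i j; lra.
have [||m [em _ _]] := @next_row_at i (xl B); [lra|by rewrite lexx xl_lt_xr|].
case: (eqVneq (yr (T i)) (yl (T j))) => [e|ne].
  by apply: connect1; apply/asboolP/above_stepP.
apply: (@connect_trans _ _ m); first by apply: connect1; apply/asboolP/above_stepP.
apply: IH; last by rewrite em lt_neqAle ne.
rewrite -ltnS; apply: leq_trans card; apply: proper_card; apply/properP; split.
  by apply/fintype.subsetP => q; rewrite !inE; lra.
by exists m; rewrite !inE; lra.
Qed.

End Full.
End Tilings.

(** * Rows *)

Section Rows.
Variables (R : realType) (B : rect R) (n : nat).
Implicit Types T : rectangulation B n.

Definition starts T (i : 'I_n) := xl (T i) == xl B.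
(* The row number is a count of first tiles of rows, so that it can be read off
   from the left-right and above-below relations. *)
Definition tile_row T (i : 'I_n) := #|[pred m | starts T m && (yl (T m) < yl (T i))]|.
Definition nb_rows T := #|starts T|.

(** Here and in [starts_before_end], right ends are avoided: only row numbers and comparisons of
    left ends occur, which is what [near_iso] preserves. *)
Definition consecutive T i j := (xl (T i) < xl (T j)) &&
  ~~ [exists m, (tile_row T m == tile_row T i) && ((xl (T i) < xl (T m)) && (xl (T m) < xl (T j)))].
Definition starts_before_end T i j :=
  ~~ [exists m, (tile_row T m == tile_row T j) && ((xl (T j) < xl (T m)) && (xl (T m) <= xl (T i)))].

Section Full.
Variable T : rectangulation B n.
Hypothesis full : full_horizontals T.
Let lx i := lo_lt_hi false (T i).
Let ly i := lo_lt_hi true (T i).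
Let bx i := tile_bounds (tile_cover T) false i.
Let by' i := tile_bounds (tile_cover T) true i.

Lemma starts_le i j : starts T i -> xl (T i) <= xl (T j).
Proof. by move=> /eqP ->; have [] := bx j. Qed.

Lemma start_of_row i : exists s, starts T s /\ yl (T s) = yl (T i).
Proof.
have [|s [es s1 s2]] := row_at full i (x := xl B); first by rewrite lexx xl_lt_xr.
by exists s; split=> //; rewrite /starts eq_le s1; have [] := bx s.
Qed.

Lemma row_mono i j : yl (T i) <= yl (T j) -> (tile_row T i <= tile_row T j)%N.
Proof.
by move=> ij; apply: subset_leq_card; apply/fintype.subsetP => m; rewrite !inE => /andP[-> /=]; lra.
Qed.

Lemma row_ltE i j : (tile_row T i < tile_row T j)%N = (yl (T i) < yl (T j)).
Proof.
apply/idP/idP; first by move=> H; rewrite ltNge; apply/negP => /row_mono; lia.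
move=> ij; have [s [ss es]] := start_of_row i.
apply: proper_card; apply/properP; split.
  by apply/fintype.subsetP => m; rewrite !inE => /andP[-> /=]; lra.
by exists s; rewrite !inE ss es /= ?ltxx.
Qed.

Lemma row_eqE i j : (tile_row T i = tile_row T j) <-> yl (T i) = yl (T j).
Proof.
split=> e; first by apply/eqP; rewrite eq_le !leNgt -!row_ltE e !ltnn.
by apply/eqP; rewrite eqn_leq !row_mono // e.
Qed.

Lemma row_lt_nb_rows i : (tile_row T i < nb_rows T)%N.
Proof.
have [s [ss es]] := start_of_row i; apply: proper_card; apply/properP; split.
  by apply/fintype.subsetP => m; rewrite !inE => /andP[].
by exists s => //; rewrite !inE es ltxx andbF.
Qed.

(** Row numbers have no gaps: moving up to the abutting row, the count gains exactly the first tile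
    of the row of [i]. *)
Lemma row_next i j : yr (T i) = yl (T j) -> tile_row T j = (tile_row T i).+1.
Proof.
move=> e; have [s [ss es]] := start_of_row i.
rewrite /tile_row (cardD1 s) !inE ss es -e; have /= -> := ly i; rewrite add1n; congr _.+1.
apply: eq_card => m; rewrite !inE; have := ly m => /= lm; have := ly i => /= li.
case: (eqVneq m s) => [->|ms] /=; first by rewrite es ltxx andbF.
case sm : (starts T m) => //=; apply/idP/idP => h; last by lra.
rewrite ltNge; apply/negP => h'.
have [e1 _] : yl (T m) = yl (T i) /\ yr (T m) = yr (T i) by apply: (row_eq full); lra.
by case/eqP: ms; apply: (row_inj full); [rewrite e1|move/eqP: sm => ->; move/eqP: ss => ->].
Qed.

Lemma row_nextP i j : tile_row T j = (tile_row T i).+1 -> yr (T i) = yl (T j).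
Proof.
move=> e; have lij : yl (T i) < yl (T j) by rewrite -row_ltE e.
have := ly i; have := ly j; have := by' j; rewrite /= => Bj lj li.
have h : yr (T i) <= yl (T j).
  by rewrite leNgt; apply/negP => h; have [] := row_eq full (i := i) (j := j); lra.
have [||m [em _ _]] := next_row_at full (i := i) (x := xl B); [lra|by rewrite lexx xl_lt_xr|].
by rewrite -em; apply/row_eqE; rewrite e; apply: row_next.
Qed.

Lemma consecutiveE i j : tile_row T i = tile_row T j -> consecutive T i j <-> xr (T i) = xl (T j).
Proof.
move=> /row_eqE ey; have := lx i; have := lx j; have := bx j => /= Bj lj li; split.
  move=> /andP[ij /existsPn no].
  have nij : i != j by apply/eqP => e; rewrite e ltxx in ij.
  have ij' : xr (T i) <= xl (T j) by have := row_sep full nij ey; lra.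
  have [|m [em mx]] := next_in_row full (i := i); first lra.
  have := no m; rewrite mx li; have /row_eqE -> := em; rewrite eqxx /=; lra.
move=> e; apply/andP; split; first by rewrite -e.
apply/existsPn => m; apply/negP => /andP[/eqP/row_eqE em mij].
have nim : i != m by apply/eqP => e'; rewrite e' ltxx in mij.
by have := row_sep full nim (esym em); have := lx m => /=; lra.
Qed.

Lemma starts_before_endE i j : starts_before_end T i j = (xl (T i) < xr (T j)).
Proof.
have := lx i; have := lx j; have := bx j; have := bx i => /= Bi Bj lj li.
apply/idP/idP.
  move=> /existsPn no; rewrite ltNge; apply/negP => h.
  have [|m [em mx]] := next_in_row full (i := j); first lra.
  by have := no m; rewrite mx lj h; have /row_eqE -> := em; rewrite eqxx.
move=> h; apply/existsPn => m; apply/negP => /andP[/eqP/row_eqE em mij].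
have njm : j != m by apply/eqP => e'; rewrite e' ltxx in mij.
by have := row_sep full njm (esym em); have := lx m => /=; lra.
Qed.

Lemma contact_rows i j : contact T i j <->
  [\/ i = j,
      tile_row T i = tile_row T j /\ (consecutive T i j \/ consecutive T j i) |
      (tile_row T j = (tile_row T i).+1 \/ tile_row T i = (tile_row T j).+1) /\
      (starts_before_end T i j && starts_before_end T j i)].
Proof.
case: (eqVneq i j) => [<-|nij].
  split=> _; first by constructor 1.
  (* By this definition a tile touches itself, for instance along its left side. *)
  exists (line true (xl (T i)) (yl (T i)) (yr (T i))); split; first exact/straight_line/ly.
    move=> q; have [e [t ->]] := pt_onto true q => /(@in_line _ true)[-> ?].
    split; first by apply/in_rect => /=; have := lx i => /=; lra.
    by move/in_interior => /= [] ; lra.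
  move=> q; have [e [t ->]] := pt_onto true q => /(@in_line _ true)[-> ?].
  split; first by apply/in_rect => /=; have := lx i => /=; lra.
  by move/in_interior => /= [] ; lra.
rewrite contactP //; have := ly i; have := ly j => /= lj li.
rewrite !starts_before_endE; split.
  move=> [[] /= [E [h1 h2]]].
    have [ey _] := row_eq full h1 h2.
    constructor 2; have er : tile_row T i = tile_row T j by apply/row_eqE.
    by split=> //; case: E => [/(consecutiveE er)|/(consecutiveE (esym er))]; [left|right].
  by constructor 3; split; [case: E => /row_next; [left|right]|rewrite h1 h2].
case=> [ij|[er E]|[E /andP[h1 h2]]]; first by rewrite ij eqxx in nij.
  exists true; have /row_eqE ey := er; have := same_yr full ey => ey' /=.
  by split; [case: E => [/(consecutiveE er)|/(consecutiveE (esym er))]; [left|right]|lra].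
by exists false; split=> //; case: E => /row_nextP; [left|right].
Qed.

Lemma right_of_rows i j : right_of T i j = (tile_row T i == tile_row T j) && (xl (T i) <= xl (T j)).
Proof.
apply/idP/andP => [/(right_ofP full)[e le]|[/eqP/row_eqE e le]]; last exact/right_ofP.
by split=> //; apply/eqP/row_eqE.
Qed.

Lemma above_rows i j : above T i j = (i == j) || (tile_row T i < tile_row T j)%N.
Proof.
rewrite row_ltE; apply/idP/orP => [/(aboveP full)[->|]|H]; [by left|by right|].
by apply/aboveP => //; case: H => [/eqP|]; [left|right].
Qed.

End Full.

(** The data retained by a strong class. For full rectangulations, such a map exists exactly when
    they are strongly equivalent. *)
Definition near_iso T T' (f : 'I_n -> 'I_n) := [/\ bijective f,
  forall i, tile_row T' (f i) = tile_row T i &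
  forall i j, near (tile_row T i) (tile_row T j) ->
    (xl (T' (f i)) <= xl (T' (f j))) = (xl (T i) <= xl (T j))].

Lemma existsb_bij (f : 'I_n -> 'I_n) (P Q : pred 'I_n) :
  bijective f -> (forall i, P (f i) = Q i) -> [exists i, P i] = [exists i, Q i].
Proof.
move=> [g fK gK] PQ; apply/existsP/existsP => -[i]; last by exists (f i); rewrite PQ.
by exists (g i); rewrite -PQ gK.
Qed.

Lemma nearxx a : near a a.
Proof. by rewrite /near leqnSn. Qed.

Lemma near_iso_strong_equiv T T' f : full_horizontals T -> full_horizontals T' ->
  near_iso T T' f -> strong_equiv T T'.
Proof.
move=> fT fT' [bf rf lf]; have injf := bij_inj bf.
have ltf i j : near (tile_row T i) (tile_row T j) ->
    (xl (T' (f i)) < xl (T' (f j))) = (xl (T i) < xl (T j)).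
  by move=> ij; rewrite !ltNge lf // /near andbC.
exists f; split=> //.
- move=> i j; rewrite !right_of_rows // !rf; case: eqP => //= e.
  by rewrite lf // e nearxx.
- by move=> i j; rewrite !above_rows // !rf (inj_eq injf).
move=> i j; rewrite !contact_rows // !rf.
have consf i' j' : tile_row T i' = tile_row T j' -> consecutive T' (f i') (f j') = consecutive T i' j'.
  move=> e; rewrite /consecutive ltf; last by rewrite e nearxx.
  congr (_ && ~~ _).
  apply: (existsb_bij bf) => m; rewrite !rf; case: eqP => //= em.
  by rewrite !ltf ?em ?e ?nearxx.
have sbef i' j' : near (tile_row T i') (tile_row T j') ->
    starts_before_end T' (f i') (f j') = starts_before_end T i' j'.
  move=> e; congr (~~ _); apply: (existsb_bij bf) => m; rewrite !rf; case: eqP => //= em.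
  by rewrite ltf ?lf ?em ?nearxx // /near andbC.
have -> : (f i = f j) = (i = j) by apply/propext; split=> [/injf|->].
split=> -[e|[e H]|[e /andP[H1 H2]]]; [by constructor 1| | |by constructor 1| |].
- by constructor 2; split=> //; move: H; rewrite !consf.
- have ij : near (tile_row T i) (tile_row T j) by rewrite /near; case: e => ->; lia.
  have ji : near (tile_row T j) (tile_row T i) by rewrite /near andbC.
  by constructor 3; split=> //; move: H1 H2; rewrite !sbef // => -> ->.
- by constructor 2; split=> //; move: H; rewrite !consf.
- have ij : near (tile_row T i) (tile_row T j) by rewrite /near; case: e => ->; lia.
  have ji : near (tile_row T j) (tile_row T i) by rewrite /near andbC.
  by constructor 3; split=> //; rewrite !sbef // H1 H2.
Qed.

Lemma starts_right_of T i : full_horizontals T ->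
  starts T i = [forall j, right_of T j i ==> (j == i)].
Proof.
move=> fT; apply/idP/forallP => [si j|H].
  apply/implyP => /(right_ofP fT)[ey ex]; apply/eqP; apply: (row_inj fT) => //.
  by apply: le_anti; rewrite ex starts_le.
have [s [ss es]] := start_of_row fT i.
by have /implyP/(_ _)/eqP <- := H s => //; apply/right_ofP => //; rewrite starts_le.
Qed.

(** If [i] starts before [j], it touches the tile [j'] of the row of [j] that contains its starting
    abscissa. Conversely, a contact makes [i'] start before [j'] ends, so [i] starts no later than
    [i'], hence before the end of [j'], which is at most the start of [j]. *)
Lemma lt_xl_contact T i j : full_horizontals T ->
  (tile_row T j = (tile_row T i).+1 \/ tile_row T i = (tile_row T j).+1) ->
  xl (T i) < xl (T j) <-> exists i' j', [/\ contact T i' j', right_of T i i',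
     right_of T j' j, j' != j & tile_row T i' != tile_row T j'].
Proof.
move=> fT adj; have := lo_lt_hi false (T i); have := lo_lt_hi false (T j) => /= lj li.
have := tile_bounds (tile_cover T) false i; have := tile_bounds (tile_cover T) false j => /= Bj Bi.
split=> [ij|[i' [j' [c /(right_ofP fT)[ei ii] /(right_ofP fT)[ej jj] nj nr]]]].
  have [|j' [ej j1 j2]] := row_at fT j (x := xl (T i)); first lra.
  have rj : tile_row T j' = tile_row T j by apply/row_eqE.
  exists i, j'; split.
  - apply/contact_rows => //; constructor 3; rewrite rj; split=> //.
    by rewrite !starts_before_endE // j2; lra.
  - exact: connect0.
  - by apply/right_ofP => //; split=> //; lra.
  - by apply/eqP => e; rewrite e leNgt ij in j1.
  - by rewrite rj; case: adj => ->; lia.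
have /eqP nji : j' != j by [].
have sep := row_sep fT nj ej; have := lo_lt_hi false (T j') => /= lj'.
move/(contact_rows fT): c => [e|[e _]|[_ /andP[+ _]]]; rewrite ?e ?eqxx // in nr.
by rewrite starts_before_endE //; lra.
Qed.

(** First tiles are the minimal ones for [right_of], and with [above] they give the row numbers.
    Left ends are then compared by [right_of] within a row and by [lt_xl_contact] between adjacent
    rows. *)
Lemma strong_equiv_near_iso T T' : full_horizontals T -> full_horizontals T' ->
  strong_equiv T T' -> exists f, near_iso T T' f.
Proof.
move=> fT fT' [f [bf rf af cf]]; exists f; have injf := bij_inj bf.
have {}cf i j : contact T' (f i) (f j) = contact T i j by exact/propext.
have sf i : starts T' (f i) = starts T i.
  rewrite !starts_right_of //; apply/forallP/forallP => H j.
    by have := H (f j); rewrite rf (inj_eq injf).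
  by case: bf => g fK gK; rewrite -[j]gK rf (inj_eq injf).
have lty i j : (yl (T' (f i)) < yl (T' (f j))) = (yl (T i) < yl (T j)).
  have H (S : rectangulation B n) a b : full_horizontals S -> 
      (yl (S a) < yl (S b)) = above S a b && (a != b).
    move=> fS; apply/idP/andP => [h|[/(aboveP fS)[->|]//]]; last by rewrite eqxx.
    by split; [apply/aboveP => //; right|apply/eqP => e; rewrite e ltxx in h].
  by rewrite !H // af (inj_eq injf).
have rowf i : tile_row T' (f i) = tile_row T i.
  rewrite /tile_row -[RHS](fintype.card_image injf); apply: eq_card => m.
  have [g fK gK] := bf; rewrite -[m]gK (fintype.mem_image injf).
  by rewrite !inE sf lty.
have ltx i j : tile_row T j = (tile_row T i).+1 \/ tile_row T i = (tile_row T j).+1 ->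
    (xl (T' (f i)) < xl (T' (f j))) = (xl (T i) < xl (T j)).
  move=> adj; apply/idP/idP => [/lt_xl_contact|/lt_xl_contact].
    rewrite !rowf => /(_ fT' adj) [i' [j' []]]; have [g fK gK] := bf.
    rewrite -[i']gK -[j']gK cf !rf (inj_eq injf) !rowf => *.
    by apply/lt_xl_contact => //; exists (g i'), (g j').
  move=> /(_ fT adj) [i' [j' [c ri rj nj nr]]]; apply/lt_xl_contact; rewrite ?rowf //.
  by exists (f i'), (f j'); rewrite cf !rf (inj_eq injf) !rowf.
split=> // i j; rewrite /near => /andP[n1 n2].
have [e|e|e] : [\/ tile_row T i = tile_row T j, tile_row T i = (tile_row T j).+1 | tile_row T j = (tile_row T i).+1].
- case: (ltngtP (tile_row T i) (tile_row T j)) => h; [constructor 3|constructor 2|constructor 1]; lia.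
- by have := rf i j; rewrite !right_of_rows // !rowf e eqxx.
- by rewrite !leNgt ltx //; left.
- by rewrite !leNgt ltx //; right.
Qed.

End Rows.

(** * The word of a rectangulation *)

Section Codes.
Variables (R : realType) (B : rect R) (n : nat).
Implicit Types T : rectangulation B n.

Definition cut_lt T : rel 'I_n := fun i j =>
  near (tile_row T i) (tile_row T j) ==> (xl (T i) < xl (T j)).

(** A cut is represented by the tiles on its right, those that do not start a row. [L] is a linear
    extension of the order imposed by near rows. *)
Definition cut_order T (L : seq 'I_n) :=
  [/\ uniq L, forall i, (i \in L) = ~~ starts T i & pairwise (cut_lt T) L].

(** A relation, since [v] is read along some list [L]; [has_code_unique] shows that the choice does
    not matter. *)
Definition has_code T (k : nat) (v : seq nat) :=
  nb_rows T = k /\ exists L, [/\ cut_order T L, map (tile_row T) L = v & normal v].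

Lemma cuts_at_distinct_x T i j : full_horizontals T -> i != j -> ~~ starts T i ->
  near (tile_row T i) (tile_row T j) -> xl (T i) != xl (T j).
Proof.
move=> fT ij si /andP[n1 n2]; apply: contraNN si => /eqP ex.
have [e|e|e] : [\/ tile_row T i = tile_row T j, tile_row T i = (tile_row T j).+1 | tile_row T j = (tile_row T i).+1].
- case: (ltngtP (tile_row T i) (tile_row T j)) => h; [constructor 3|constructor 2|constructor 1]; lia.
- by case/eqP: ij; apply: (row_inj fT) => //; apply/row_eqE.
- by rewrite /starts ex; apply/eqP; apply: (cuts_differ fT (j := i)) => //; apply: row_nextP.
- by apply/eqP; apply: (cuts_differ fT (j := j)) => //; apply: row_nextP.
Qed.

(** Sorting by abscissa gives a cut order, as ties occur only between rows that are not near;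
    insertion then makes it normal. *)
Lemma cut_order_exists T : full_horizontals T ->
  exists2 L, cut_order T L & normal (map (tile_row T) L).
Proof.
move=> fT.
pose L0 := sort (fun i j => xl (T i) <= xl (T j)) [seq i <- enum 'I_n | ~~ starts T i].
have tot : total (fun i j => xl (T i) <= xl (T j)) by move=> i j; exact: le_total.
have trn : transitive (fun i j => xl (T i) <= xl (T j)).
  by move=> i j m; exact: le_trans.
have mem0 i : (i \in L0) = ~~ starts T i by rewrite mem_sort mem_filter mem_enum andbT.
have uniq0 : uniq L0 by rewrite sort_uniq filter_uniq ?enum_uniq.
have p0 : pairwise (cut_lt T) L0.
  have : pairwise (fun i j => (xl (T i) <= xl (T j)) && (i != j)) L0.
    by rewrite pairwise_relI -uniq_pairwise uniq0 andbT -sorted_pairwise // sort_sorted.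
  apply: (sub_in_pairwise (P := fun i => ~~ starts T i)); last first.
    by apply/allP => i; rewrite mem0.
  move=> i j si sj /andP[ij nij]; apply/implyP => nr.
  by rewrite lt_neqAle ij (cuts_at_distinct_x fT nij si nr).
have [L LL0 [pL sL]] := normal_rearrangement p0.
exists L; last by rewrite /normal sorted_map.
by split=> //; [rewrite (perm_uniq LL0)|move=> i; rewrite (perm_mem LL0)].
Qed.

Lemma has_code_exists T : full_horizontals T -> (0 < n)%N ->
  exists k v, has_code T k v /\ is_code n k v.
Proof.
move=> fT n0; have [L oL nL] := cut_order_exists fT.
exists (nb_rows T), (map (tile_row T) L); split; first by split=> //; exists L.
apply/and4P; split=> //.
- have [s [ss _]] := start_of_row fT (Ordinal n0).
  by apply/card_gt0P; exists s.
- have [uL mL _] := oL; rewrite size_map -(card_uniqP uL).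
  have -> : #|L| = #|[predC starts T]| by apply: eq_card => i; rewrite mL !inE.
  by rewrite addnC /nb_rows cardC card_ord.
- by apply/allP => _ /mapP[i _ ->]; exact: row_lt_nb_rows.
Qed.

(** Restricted to rows [j] and [j.+1], any two cut orders are strictly sorted by abscissa with the
    same elements, hence equal. So the words have the same projections. *)
Lemma has_code_unique T k v k' v' : has_code T k v -> has_code T k' v' -> k = k' /\ v = v'.
Proof.
move=> [<- [L [[uL mL pL] <- nv]]] [<- [L' [[uL' mL' pL'] <- nv']]]; split=> //.
apply: normal_unique => // j; rewrite !filter_map; congr map.
have sub M : pairwise (cut_lt T) M ->
    sorted (fun a b => xl (T a) < xl (T b)) (filter (preim (tile_row T) (mem [:: j; j.+1])) M).
  move=> pM; apply: pairwise_sorted; move: (pairwise_filter (preim (tile_row T) (mem [:: j; j.+1])) pM).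
  apply: sub_in_pairwise; last exact: filter_all.
  move=> a b; rewrite !inE => ha hb /implyP; apply.
  by case/orP: ha => /eqP ->; case/orP: hb => /eqP ->; rewrite /near; lia.
apply: (@irr_sorted_eq _ (fun a b => xl (T a) < xl (T b))).
- by move=> a b c; exact: lt_trans.
- by move=> a; exact: ltxx.
- exact: sub.
- exact: sub.
- by move=> i; rewrite !mem_filter mL mL'.
Qed.

(** * The word as a complete invariant of strong equivalence *)

Lemma starts_in_row T i : full_horizontals T ->
  starts T i = [forall j, (tile_row T j == tile_row T i) ==> (xl (T i) <= xl (T j))].
Proof.
move=> fT; apply/idP/forallP => [si j|H]; first by rewrite starts_le // implybT.
have [s [ss es]] := start_of_row fT i.
have /implyP := H s; have /row_eqE -> // := es; rewrite eqxx => /(_ isT) is_.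
by rewrite /starts eq_le -{1}(eqP ss) is_ /starts; have [] := tile_bounds (tile_cover T) false i.
Qed.

Lemma near_iso_starts T T' f i : full_horizontals T -> full_horizontals T' ->
  near_iso T T' f -> starts T' (f i) = starts T i.
Proof.
move=> fT fT' [bf rf lf]; rewrite !starts_in_row //; have [g fK gK] := bf.
apply/forallP/forallP => H j; [have := H (f j)|rewrite -[j]gK; have := H (g j)];
  by rewrite !rf; case: eqP => //= e; rewrite lf ?e ?nearxx.
Qed.

Lemma has_code_near_iso T T' f k v : full_horizontals T -> full_horizontals T' ->
  near_iso T T' f -> has_code T k v -> has_code T' k v.
Proof.
move=> fT fT' iso [Ek [L [[uL mL pL] Ev nv]]].
have sf i := near_iso_starts i fT fT' iso; have [bf rf lf] := iso.
have injf := bij_inj bf; have [g fK gK] := bf; split.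
  rewrite -Ek /nb_rows -[RHS](fintype.card_image injf); apply: eq_card => i.
  by rewrite -[i]gK (fintype.mem_image injf) -!topredE /= sf.
exists (map f L); split=> //; last by rewrite -map_comp -Ev; apply: eq_map => i /=.
split; first by rewrite map_inj_uniq.
  by move=> i; rewrite -[i]gK mem_map // mL sf.
rewrite pairwise_map; apply: sub_pairwise pL => i j; rewrite /= /cut_lt !rf.
case nij : near => //=; rewrite !ltNge lf // /near andbC //.
Qed.

Definition start_list T := sort (fun i j => tile_row T i <= tile_row T j)%N (enum (starts T)).

Lemma mem_start_list T i : (i \in start_list T) = starts T i.
Proof. by rewrite mem_sort mem_enum. Qed.

Lemma size_start_list T : size (start_list T) = nb_rows T.
Proof. by rewrite size_sort -cardE. Qed.

Lemma row_start_list T : full_horizontals T ->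
  map (tile_row T) (start_list T) = iota 0 (nb_rows T).
Proof.
move=> fT.
have us : uniq (map (tile_row T) (start_list T)).
  rewrite map_inj_in_uniq ?sort_uniq ?enum_uniq // => i j.
  rewrite !mem_start_list => /eqP si /eqP sj /row_eqE e.
  by apply: (row_inj fT); [exact: e|rewrite si sj].
have sorted_s : sorted leq (map (tile_row T) (start_list T)).
  by rewrite sorted_map sort_sorted // => i j; exact: leq_total.
apply: (@irr_sorted_eq _ ltn); [exact: ltn_trans|exact: ltnn| |exact: iota_ltn_sorted|].
  by rewrite ltn_sorted_uniq_leq us.
have sub : {subset map (tile_row T) (start_list T) <= iota 0 (nb_rows T)}.
  by move=> _ /mapP[i _ ->]; rewrite mem_iota row_lt_nb_rows.
have [] := uniq_min_size us sub; rewrite ?size_map ?size_iota ?size_start_list //.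
Qed.

Section FullOrder.
Variables (T : rectangulation B n) (L : seq 'I_n).
Hypothesis oL : cut_order T L.
Let M := start_list T ++ L.

Lemma uniq_full_order : uniq M.
Proof.
have [uL mL _] := oL; rewrite cat_uniq uL sort_uniq enum_uniq andbT /=.
by apply/hasPn => i; rewrite mL mem_start_list.
Qed.

Lemma mem_full_order i : i \in M.
Proof. by have [_ mL _] := oL; rewrite mem_cat mL mem_start_list orbN. Qed.

Lemma size_full_order : size M = n.
Proof.
rewrite -(card_uniqP uniq_full_order) -[RHS]card_ord; apply: eq_card => i.
by rewrite mem_full_order.
Qed.

Lemma index_start i : (index i M < nb_rows T)%N = starts T i.
Proof.
rewrite index_cat mem_start_list -size_start_list; case: ifP => si.
  by rewrite index_mem mem_start_list.
by rewrite ltnNge leq_addr.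
Qed.

(** Positions in [M] determine the order of left ends in near rows: the first [nb_rows T] tiles
    share the left side of [B], and the others follow in strict order. *)
Lemma xl_full_order i j : near (tile_row T i) (tile_row T j) ->
  (xl (T i) <= xl (T j)) = (index i M < nb_rows T)%N || (index i M <= index j M)%N.
Proof.
move=> nij; rewrite index_start; case: (boolP (starts T i)) => si /=; first exact: starts_le.
have [uL mL pL] := oL.
case: (boolP (starts T j)) => sj.
  have := index_start j; have := index_start i; rewrite sj (negPf si) => /negbT ? ?.
  have -> : (index i M <= index j M)%N = false by lia.
  apply/negbTE; rewrite -ltNge lt_neqAle starts_le // andbT (eqP sj) eq_sym; exact: si.
rewrite !index_cat !mem_start_list (negPf si) (negPf sj) leq_add2l.
have iL : i \in L by rewrite mL.
have jL : j \in L by rewrite mL.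
have lt a b : a \in L -> b \in L -> near (tile_row T a) (tile_row T b) -> (index a L < index b L)%N ->
    xl (T a) < xl (T b).
  move=> aL bL nab ab; move/(pairwiseP a): pL => /(_ (index a L) (index b L)).
  by rewrite !inE !index_mem !nth_index // /cut_lt nab; apply.
case: (ltngtP (index i L) (index j L)) => h.
- by rewrite ltW // lt.
- by apply/negbTE; rewrite -ltNge lt // /near andbC.
- by rewrite -(nth_index i iL) h nth_index // lexx.
Qed.

End FullOrder.

Lemma has_code_strong_equiv T T' k v : full_horizontals T -> full_horizontals T' ->
  has_code T k v -> has_code T' k v -> strong_equiv T T'.
Proof.
move=> fT fT' [Ek [L [oL Ev _]]] [Ek' [L' [oL' Ev' _]]].
pose M := start_list T ++ L; pose M' := start_list T' ++ L'.
have uM := uniq_full_order oL; have uM' := uniq_full_order oL'.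
have sM := size_full_order oL; have sM' := size_full_order oL'.
have mM := mem_full_order oL; have mM' := mem_full_order oL'.
have rM : map (tile_row T) M = map (tile_row T') M'.
  by rewrite !map_cat !row_start_list // Ek Ek' Ev Ev'.
have ltM i : (index i M < size M')%N by rewrite sM' (leq_trans _ (eq_leq sM)) // index_mem.
(* Tiles are matched by position; the rows along [M] and [M'] spell the same word, namely 0, ..., k
   - 1 followed by [v]. *)
pose f i := nth i M' (index i M).
have idf i : index (f i) M' = index i M.
  exact: index_uniq.
have injf : injective f.
  move=> i j fij; have : index i M = index j M by rewrite -!idf fij.
  by move=> e; rewrite -(nth_index i (mM i)) e nth_index.
apply: (near_iso_strong_equiv (f := f)) => //.
have rf i : tile_row T' (f i) = tile_row T i.
  rewrite -(nth_map i 0%N (tile_row T')) //.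
  by rewrite -rM (nth_map i) ?index_mem // nth_index.
split=> // [|i j nij]; first exact: injF_bij.
by rewrite (xl_full_order oL') ?rf // (xl_full_order oL) // !idf Ek Ek'.
Qed.

End Codes.

(** * Rectangulations with a given word *)

Lemma regular_grid (R : realType) (a b : R) (m : nat) : a < b -> (0 < m)%N ->
  exists g : nat -> R, [/\ g 0%N = a, g m = b & {mono g : i j / (i <= j)%N >-> i <= j}].
Proof.
move=> ab m0; exists (fun i => a + (b - a) / m%:R * i%:R).
have mR : 0 < m%:R :> R by rewrite ltr0n.
split; first by rewrite mulr0 addr0.
  by rewrite divfK ?gt_eqF //; lra.
by move=> i j; rewrite lerD2l ler_pM2l ?ler_nat // divr_gt0 // subr_gt0.
Qed.

Lemma grid_cell (R : realType) (g : nat -> R) (y : R) (k : nat) : (0 < k)%N ->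
  g 0%N <= y <= g k -> exists2 j, (j < k)%N & g j <= y <= g j.+1.
Proof.
elim: k => [//|k IH] _ /andP[y0 yk]; have [gy|gy] := leP (g k) y.
  by exists k; rewrite ?gy.
case: k IH yk gy => [|k] IH yk gy; first by rewrite leNgt gy in y0.
by have [||j jk yj] := IH; rewrite ?y0 ?ltW //; exists j => //; lia.
Qed.

Lemma card_ltn_ord (n c : nat) : (c <= n)%N -> #|[pred m : 'I_n | (m < c)%N]| = c.
Proof.
move=> cn; rewrite -[RHS](card_ord c).
have inj : injective (widen_ord cn) by move=> i j [e]; apply: val_inj.
rewrite -[RHS](fintype.card_image inj); apply: eq_card => m; rewrite inE.
apply/idP/fintype.imageP => [mc|[i _ ->]]; last exact: (ltn_ord i).
by exists (Ordinal mc) => //; apply: val_inj.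
Qed.

Section Realization.
Variables (R : realType) (B : rect R) (n k : nat) (v : seq nat).
Hypothesis code : is_code n k v.

Let k0 : (0 < k)%N. Proof. by case/and4P: code. Qed.
Let nE : (size v + k = n)%N. Proof. by case/and4P: code => _ /eqP. Qed.

(* Tile [t] lies in row [srow t].  The first [k] tiles start at the left side; each
   later one starts at its own grid abscissa [spos t], and a tile ends where the
   next tile of its row starts. *)
Definition row_seq := iota 0 k ++ v.
Definition srow (t : nat) := nth 0%N row_seq t.
(** Truncation sends the first [k] tiles to 0. The value [n], which [snext] takes after the last
    tile of a row, is sent to [(size v).+1], the right side. *)
Definition spos (t : nat) := (t.+1 - k)%N.
Definition snext (t : nat) := (t.+1 + find (pred1 (srow t)) (drop t.+1 row_seq))%N.

Lemma size_row_seq : size row_seq = n.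
Proof. by rewrite size_cat size_iota addnC. Qed.

Lemma srow_start t : (t < k)%N -> srow t = t.
Proof. by move=> tk; rewrite /srow nth_cat size_iota tk nth_iota. Qed.

Lemma srow_lt t : (t < n)%N -> (srow t < k)%N.
Proof.
move=> tn; case: (ltnP t k) => tk; first by rewrite srow_start.
have /and4P[_ _ /allP vk _] := code.
rewrite /srow nth_cat size_iota [(t < k)%N]ltnNge tk /=; apply: vk; have h : (t - k < size v)%N by lia.
exact: mem_nth.
Qed.

Lemma snext_le t : (t < n)%N -> (t < snext t <= n)%N.
Proof.
move=> tn; rewrite /snext leq_addr /=.
have := find_size (pred1 (srow t)) (drop t.+1 row_seq).
by rewrite size_drop size_row_seq; set d := find _ _; lia.
Qed.

Lemma srow_next t : (snext t < n)%N -> srow (snext t) = srow t.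
Proof.
move=> h; have hs : has (pred1 (srow t)) (drop t.+1 row_seq).
  by rewrite has_find size_drop size_row_seq; move: h; rewrite /snext; lia.
by have := nth_find 0%N hs; rewrite nth_drop => /eqP.
Qed.

Lemma srow_before_next t s : (t < s < snext t)%N -> srow s != srow t.
Proof.
move=> /andP[ts sn]; have := @before_find _ 0%N (pred1 (srow t)) (drop t.+1 row_seq) (s - t.+1)%N.
rewrite nth_drop subnKC // => H; apply/negbT/H.
by move: sn; rewrite /snext; set d := find _ _; lia.
Qed.

Lemma snext_ge t : (t < n)%N -> (k <= snext t)%N.
Proof.
move=> tn; have /andP[t1 t2] := snext_le tn; rewrite leqNgt; apply/negP => h.
by have := srow_next (leq_trans h _); rewrite !srow_start; lia.
Qed.

Lemma spos_lt t s : (k <= s)%N -> (t < s)%N -> (spos t < spos s)%N.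
Proof. rewrite /spos; lia. Qed.

Lemma spos_inj t s : (k <= t)%N -> (k <= s)%N -> spos t = spos s -> t = s.
Proof. rewrite /spos; lia. Qed.

Section Grid.
Variables gx gy : nat -> R.
Hypotheses (gx0 : gx 0%N = xl B) (gxm : gx (size v).+1 = xr B)
  (gxM : {mono gx : i j / (i <= j)%N >-> i <= j}).
Hypotheses (gy0 : gy 0%N = yl B) (gyk : gy k = yr B)
  (gyM : {mono gy : i j / (i <= j)%N >-> i <= j}).

Let gxL i j : (gx i < gx j) = (i < j)%N.
Proof. by rewrite ltNge gxM -ltnNge. Qed.
Let gyL i j : (gy i < gy j) = (i < j)%N.
Proof. by rewrite ltNge gyM -ltnNge. Qed.
Let gxI : injective gx.
Proof. by move=> i j e; apply/eqP; rewrite eqn_leq -!gxM e lexx. Qed.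

Lemma stile_x (t : 'I_n) : gx (spos t) < gx (spos (snext t)).
Proof.
by rewrite gxL; have /andP[? _] := snext_le (ltn_ord t); apply: spos_lt => //; apply: snext_ge.
Qed.

Lemma stile_y (t : 'I_n) : gy (srow t) < gy (srow t).+1.
Proof. by rewrite gyL. Qed.

Definition stile (t : 'I_n) := Rect (stile_x t) (stile_y t).

Let spos_n : spos n = (size v).+1.
Proof. by rewrite /spos; lia. Qed.

(** The last tile of row [j] starting at or before [x] contains [x], since its successor in the row
    starts later. *)
Lemma row_cover (j : nat) (x : R) : (j < k)%N -> xl B <= x <= xr B ->
  exists t : 'I_n, srow t = j /\ xl (stile t) <= x <= xr (stile t).
Proof.
move=> jk /andP[x1 x2].
pose P t := [&& (t < n)%N, srow t == j & gx (spos t) <= x].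
have exP : exists t, P t.
  exists j; rewrite /P srow_start // eqxx /=; apply/andP; split; first lia.
  by have -> : spos j = 0%N; [rewrite /spos; lia|rewrite gx0].
have bP t : P t -> (t <= n)%N by move=> /and3P[/ltnW].
case: (ex_maxnP exP bP) => t /and3P[tn /eqP rt xt] max.
exists (Ordinal tn); split=> //=; rewrite xt /=.
have /andP[tnx nxn] := snext_le tn.
case: (ltnP (snext t) n) => h; last first.
  by have -> : snext t = n by [lia|]; rewrite spos_n gxm.
rewrite leNgt; apply/negP => h'; have := max (snext t).
by rewrite /P h srow_next // rt eqxx ltW // => /(_ isT); lia.
Qed.

Lemma stile_bounds t : [/\ xl B <= xl (stile t), xr (stile t) <= xr B,
  yl B <= yl (stile t) & yr (stile t) <= yr B].
Proof.
rewrite /= -gx0 -gxm -gy0 -gyk -spos_n !gxM !gyM; split=> //.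
- by rewrite /spos; have /andP[_ ?] := snext_le (ltn_ord t); lia.
- exact: srow_lt.
Qed.

Lemma stile_cover : \bigcup_i rect_set (stile i) = rect_set B.
Proof.
apply/seteqP; split=> [p [t _]|p].
  have [c [e ->]] := pt_onto true p => /in_rect H; apply/in_rect; move: H => /= H.
  by have := stile_bounds t; rewrite /=; case; lra.
have [x [y ->]] := pt_onto true p => /in_rect [/= xB yB].
have [|j jk yj] := @grid_cell _ gy y k k0; first by rewrite gy0 gyk.
have [t [rt xt]] := row_cover jk xB; exists t => //; apply/(@in_rect _ true); split=> //=.
by rewrite rt.
Qed.

Lemma stile_disjoint i j : i != j -> rect_interior (stile i) `&` rect_interior (stile j) = set0.
Proof.
wlog ij : i j / (i < j)%N.
  move=> W nij; case: (ltngtP i j) => h; [exact: W| |by case/eqP: nij; apply: val_inj].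
  by rewrite setIC; apply: W => //; rewrite eq_sym.
move=> _; apply/seteqP; split=> // p []; have [x [y ->]] := pt_onto true p.
move=> /in_interior [/= xi yi] /(@in_interior _ true) [/= xj yj].
have [e|ne] := eqVneq (srow i) (srow j).
  have : (snext i <= j)%N.
    by rewrite leqNgt; apply/negP => h; have := @srow_before_next i j; rewrite ij h e eqxx => /(_ isT).
  have : (spos (snext i) <= spos j)%N -> gx (spos (snext i)) <= gx (spos j) by rewrite gxM.
  rewrite /spos; move=> H h; suff : gx ((snext i).+1 - k) <= gx (j.+1 - k) by lra.
  by apply: H; lia.
case: (ltngtP (srow i) (srow j)) => h; last by rewrite h eqxx in ne.
  by have : gy (srow i).+1 <= gy (srow j) by [rewrite gyM|]; lra.
by have : gy (srow j).+1 <= gy (srow i) by [rewrite gyM|]; lra.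
Qed.

Lemma stile_on_vertical (t : 'I_n) x : on_line stile true x t -> xl B < x < xr B ->
  exists2 c, x = gx (spos c) & (k <= c)%N /\ srow t = srow c.
Proof.
rewrite -gx0 -gxm -spos_n => /orP[]/eqP /= <-; rewrite !gxL => /andP[h1 h2].
  by exists t => //; split=> //; move: h1; rewrite /spos; lia.
exists (snext t) => //; split; first exact: snext_ge.
by rewrite srow_next //; move: h2; rewrite /spos; lia.
Qed.

Lemma stile_on_horizontal (t : 'I_n) y : on_line stile false y t -> exists p, y = gy p.
Proof. by case/orP => /eqP /= <-; [exists (srow t)|exists (srow t).+1]. Qed.

(** A crossing vertical segment would contain sides of tiles below and above the horizontal one.
    Each side sits at a cut of its own row, and equal abscissas force the same cut, which lies in
    one row only. *)
Lemma stile_generic : generic B stile.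
Proof.
move=> x y1 y2 y x1 x2 /(@segment_lineE _ _ _ _ stile_cover true)[U xB _].
move=> /(@segment_lineE _ _ _ _ stile_cover false)[[x12 U'] /= yB _] [xx yy].
have [|t [/stile_on_horizontal [p yE] _ _ _]] := U' x; first lra.
(* The height is inside [B], so it is not [gy 0] and there is a row [p] below it. *)
case: p yE => [|p] yE; first by move: yB; rewrite yE gy0 ltxx.
have [_ {}U] := U.
have gp : gy p < gy p.+1 by rewrite gyL.
have gp' : gy p.+1 < gy p.+2 by rewrite gyL.
have [s [s1 s2]] : exists s, y1 < s < y /\ gy p < s < gy p.+1 by apply: itv_common; lra.
have [s' [s1' s2']] : exists s, y < s < y2 /\ gy p.+1 < s < gy p.+2 by apply: itv_common; lra.
have [|t1 [/stile_on_vertical o1 _ _ /= b1]] := U s; first lra.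
have [|t2 [/stile_on_vertical o2 _ _ /= b2]] := U s'; first lra.
have [c1 e1 [kc1 r1]] := o1 xB; have [c2 e2 [kc2 r2]] := o2 xB.
have c12 : c1 = c2 by apply: spos_inj => //; apply: gxI; rewrite -e1 -e2.
have a1 : gy (srow t1) < gy p.+1 by lra.
have a2 : gy p.+1 < gy (srow t2).+1 by lra.
by move: a1 a2; rewrite !gyL r1 r2 c12 => a1; rewrite ltnS ltnNge -ltnS a1.
Qed.

Definition realization : rectangulation B n :=
  Rectangulation stile_cover stile_disjoint stile_generic.

Lemma realization_full : full_horizontals realization.
Proof.
move=> S [sg [y [x1 [x2 [x12 SE]]]]]; exists y; rewrite SE in sg *.
move/(@segment_lineE _ _ _ _ stile_cover false): sg => [U /= yB max].
have [U1 U2] := tiled_line_bounds stile_cover U; rewrite /= in U1 U2.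
have [_ H] := U.
have [|t [/stile_on_horizontal [p yE] _ _ _]] := H x1; first by rewrite lexx ltW.
have pk : (p < k)%N by rewrite -gyL gyk -yE; lra.
(* The bottoms of row [p] tile the whole width at this height, so maximality makes the segment
   full. *)
suff U0 : tiled_line stile false y (xl B) (xr B) by have [-> ->] := max _ _ U0 U1 U2.
split; first exact: xl_lt_xr.
move=> x xB; have [s [rs xs]] := row_cover pk xB; exists s.
have [b1 b2 _ _] := stile_bounds s.
by split=> //; rewrite /on_line /= rs yE eqxx.
Qed.

Lemma realization_starts t : starts realization t = (t < k)%N.
Proof.
rewrite /starts /= -gx0 (inj_eq gxI) /spos; lia.
Qed.

Lemma realization_row t : tile_row realization t = srow t.
Proof.
rewrite /tile_row -[RHS](@card_ltn_ord n); last by have := srow_lt (ltn_ord t); lia.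
apply: eq_card => m; rewrite !inE realization_starts /= gyL.
have rt := srow_lt (ltn_ord t); case: (ltnP m k) => mk /=; first by rewrite (srow_start mk).
by rewrite ltnNge (leq_trans (ltnW rt) mk).
Qed.

(** The tiles from [k] on, in the order of their labels, form a cut order by [spos_lt], and their
    rows spell [v]. *)
Lemma realization_code : has_code realization k v.
Proof.
split.
  rewrite /nb_rows -[RHS](@card_ltn_ord n); last lia.
  by apply: eq_card => m; rewrite !inE -topredE /= realization_starts.
have vL : map val (drop k (enum 'I_n)) = iota k (n - k).
  by rewrite map_drop val_enum_ord drop_iota add0n.
have mL (i : 'I_n) : (i \in drop k (enum 'I_n)) = (k <= i)%N.
  rewrite -(mem_map val_inj) vL mem_iota /=; have h := ltn_ord i; lia.
exists (drop k (enum 'I_n)); split; last by case/and4P: code.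
  split; first by rewrite drop_uniq ?enum_uniq.
    by move=> i; rewrite realization_starts mL leqNgt.
  have : pairwise ltn (map val (drop k (enum 'I_n))).
    by rewrite vL -sorted_pairwise ?iota_ltn_sorted //; exact: ltn_trans.
  rewrite pairwise_map; apply: (sub_in_pairwise (P := fun i : 'I_n => (k <= i)%N)).
    move=> i j ki kj /= ij; apply/implyP => _ /=; rewrite gxL; exact: spos_lt.
  by apply/allP => i; rewrite mL.
rewrite (eq_map realization_row) (map_comp srow val) vL /srow.
have := @map_nth_iota _ 0%N row_seq k (n - k); rewrite size_row_seq => ->; last lia.
by rewrite /row_seq drop_size_cat ?size_iota // take_oversize //; lia.
Qed.

End Grid.

Lemma code_realized : exists2 T : rectangulation B n, full_horizontals T & has_code T k v.
Proof.
have [gx [gx0 gxm gxM]] := regular_grid (xl_lt_xr B) (ltn0Sn (size v)).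
have [gy [gy0 gyk gyM]] := regular_grid (yl_lt_yr B) k0.
exists (realization gx0 gxm gxM gy0 gyk gyM); [exact: realization_full|exact: realization_code].
Qed.

End Realization.

(** * Counting *)

Section Counting.
Variables (R : realType) (B : rect R) (n : nat).
Hypothesis n0 : (0 < n)%N.
Implicit Types T : rectangulation B n.

Lemma nb_rows_gt0 T : full_horizontals T -> (0 < nb_rows T)%N.
Proof. by move=> fT; have [s [ss _]] := start_of_row fT (Ordinal n0); apply/card_gt0P; exists s. Qed.

(** Each horizontal segment is the floor of exactly one row other than the lowest; [A] collects the
    first tiles of these rows. *)
Lemma hsegments_card T : full_horizontals T ->
  ([set S | hsegment B T S] #= `I_(nb_rows T - 1))%card.
Proof.
move=> fT; pose A := [pred i | starts T i && (yl (T i) != yl B)].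
have bounds d i := tile_bounds (tile_cover T) d i.
have rowA y i : on_line T false y i -> yl B < y < yr B -> exists2 s, A s & yl (T s) = y.
  move=> yi yB; have [j yj] : exists j, yl (T j) = y.
    case/orP: yi => /eqP /= yi; first by exists i.
    have [||j [yj _ _]] := next_row_at fT (i := i) (x := xl B); first by rewrite yi; lra.
      by rewrite lexx xl_lt_xr.
    by exists j; rewrite yj.
  have [s [ss ys]] := start_of_row fT j.
  by exists s; rewrite ?inE ?ss /= ys yj //; case/andP: yB => /gt_eqF ->.
have <- : (fun i => line false (yl (T i)) (xl B) (xr B)) @` [set i | A i] =
    [set S | hsegment B T S].
  apply/seteqP; split=> [_ [i /andP[si yi] <-]|S hS].
    split; last by exists (yl (T i)), (xl B), (xr B); split=> //; exact: xl_lt_xr.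
    apply: (full_line fT (i := i)); first by rewrite /on_line eqxx.
    rewrite lt_neqAle eq_sym yi /=; have := bounds true i; have := lo_lt_hi true (T i) => /=; lra.
  have [y SE] := fT S hS; have [sg _] := hS; rewrite SE in sg *.
  move/(@segment_lineE _ _ _ _ (tile_cover T) false): sg => [[_ U] yB _].
  have [|i [yi _ _ _]] := U (xl B); first by rewrite lexx ltW ?xl_lt_xr.
  by have [s As ys] := rowA _ _ yi yB; exists s => //; rewrite ys.
apply: (card_eq_trans (inj_card_eq _)).
  move=> i j; rewrite !inE => /andP[/eqP si _] /andP[/eqP sj _] e.
  have := @line_sub _ false (yl (T i)) _ _ (yl (T j)) (xl B) (xr B) (ltW (xl_lt_xr B)).
  by rewrite e => /(_ (@subset_refl _ _)) [ey _ _]; apply: (row_inj fT); rewrite // si sj.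
apply: (card_eq_trans (card_eq_pred A)).
suff -> : (nb_rows T - 1)%N = #|A| by rewrite card_eqxx.
(* The tile at the lower left corner is the only first tile outside [A]. *)
have [||i [/andP[xi _] /andP[yi _]]] := @tile_at _ _ _ T (xl B) (yl B);
  [by rewrite lexx xl_lt_xr|by rewrite lexx yl_lt_yr|].
have ei : xl (T i) = xl B by apply: le_anti; rewrite xi /=; have [] := bounds false i.
have fi : yl (T i) = yl B by apply: le_anti; rewrite yi /=; have [] := bounds true i.
have si : starts T i by rewrite /starts ei.
rewrite /nb_rows (cardD1 i) -topredE /= si add1n subn1 /=; apply: eq_card => j.
rewrite !inE; case: (eqVneq j i) => [->|ji] /=; first by rewrite fi eqxx andbF.
rewrite -[j \in _]topredE /=; case sj: (starts T j) => //=; symmetry; apply: contra_neq ji => yj.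
by apply: (row_inj fT); [rewrite yj|move/eqP: sj => ->].
Qed.

Lemma strong_equiv_refl T : strong_equiv T T.
Proof. by exists id; split=> //; exists id. Qed.

Lemma strong_equiv_sym T T' : strong_equiv T T' -> strong_equiv T' T.
Proof.
move=> [f [[g fK gK] rf af cf]]; exists g; split; first by exists f.
- by move=> i j; rewrite -rf !gK.
- by move=> i j; rewrite -af !gK.
- by move=> i j; have := cf (g i) (g j); rewrite !gK => -[]; split.
Qed.

Lemma strong_equiv_trans T T' T'' :
  strong_equiv T T' -> strong_equiv T' T'' -> strong_equiv T T''.
Proof.
move=> [f [bf rf af cf]] [g [bg rg ag cg]]; exists (g \o f); split.
- exact: bij_comp.
- by move=> i j; rewrite /= rg rf.
- by move=> i j; rewrite /= ag af.
- by move=> i j; split=> [/cg/cf|/cf/cg].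
Qed.

Lemma strong_class_eq T T' : strong_class T = strong_class T' <-> strong_equiv T T'.
Proof.
split=> [e|TT']; first by have : strong_class T T' by rewrite e; exact: strong_equiv_refl.
apply/seteqP; split=> U /=; apply: strong_equiv_trans; last exact: TT'.
exact: strong_equiv_sym.
Qed.

(** The bijection goes from codes to classes, by choosing a realization of each code. Equal codes
    give equivalent rectangulations, whence surjectivity; an equivalence transports the unique code,
    whence injectivity. *)
Lemma strong_classes_card (Q : pred nat) :
  (@strong_class R B n @` [set T | full_horizontals T /\ Q (nb_rows T)] #=
   [set c : nat * seq nat | is_code n c.1 c.2 && Q c.1])%card.
Proof.
have /choice[r rP] : forall c, exists C : set (rectangulation B n), is_code n c.1 c.2 ->
    exists T, [/\ full_horizontals T, has_code T c.1 c.2 & C = strong_class T].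
  move=> c.
  case: (boolP (is_code n c.1 c.2)) => hc; last by exists set0.
  by have [T fT cT] := code_realized B hc; exists (strong_class T) => _; exists T.
have <- : r @` [set c | is_code n c.1 c.2 && Q c.1] =
    @strong_class R B n @` [set T | full_horizontals T /\ Q (nb_rows T)].
  apply/seteqP; split=> [_ [c /andP[hc Qc] <-]|_ [T [fT QT] <-]].
    have [T [fT cT ->]] := rP c hc; exists T => //; split=> //.
    by have [-> _] := cT.
  have [k [v [cT hc]]] := has_code_exists fT n0; have [kE _] := cT.
  exists (k, v); first by rewrite /= hc -kE.
  have [T' [fT' cT' ->]] := rP (k, v) hc.
  by apply/strong_class_eq; apply: has_code_strong_equiv cT.
apply: inj_card_eq => -[k v] [l w]; rewrite !inE => /andP[/rP[T [fT cT ->]] _].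
move=> /andP[/rP[T' [fT' cT' ->]] _] /strong_class_eq /(strong_equiv_near_iso fT fT') [f iso].
by have [/= -> ->] := has_code_unique (has_code_near_iso fT fT' iso cT) cT'.
Qed.

End Counting.

Theorem theorem13 (R : realType) (B : rect R) (n : nat) (n_ge1 : (1 <= n)%N) :
  (forall k : nat, (1 <= k)%N ->
     (strong_full_with B n (k - 1) #= `I_(nb_rushed_height (n + 1) (k + 1)))%card)
  /\ (strong_full B n #= `I_(nb_rushed (n + 1)))%card.
Proof.
have main Q := card_eq_trans (strong_classes_card B n_ge1 Q) (codes_card Q n_ge1).
split=> [k k1|].
  have -> : strong_full_with B n (k - 1) =
      @strong_class R B n @` [set T | full_horizontals T /\ nb_rows T == k].
    congr (_ @` _); apply/seteqP; split=> T /= [fT]; have h := hsegments_card fT.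
      rewrite (card_eql h) => /card_eq_II e; split=> //.
      (* Equality of the truncated differences gives [nb_rows T = k] because both numbers are
         positive. *)
      by have := nb_rows_gt0 n_ge1 fT; lia.
    by move=> /eqP <-.
  have -> : nb_rushed_height (n + 1) (k + 1) = #|[pred p : (2 * (n + 1)).-tuple bool |
      [&& dyck p, rushed p & (height p).-1 == k]]|; last exact: (main (pred1 k)).
  apply: eq_card => p; rewrite !inE; do 2 congr (_ && _); apply/eqP/eqP; lia.
have -> : strong_full B n = @strong_class R B n @` [set T | full_horizontals T /\ true].
  by congr (_ @` _); apply/seteqP; split=> T /= => [|[]].
have -> : nb_rushed (n + 1) = #|[pred p : (2 * (n + 1)).-tuple bool |
    [&& dyck p, rushed p & true]]|; last exact: (main predT).
by apply: eq_card => p; rewrite !inE andbT.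
Qed.
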